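(* Let $0\leq\alpha<\frac{\nu\bar\lambda_1}{4}$, and let $\Delta t>0$ satisfy $\big(\frac{\nu\Delta t\bar\lambda_1}{4}+1\big)>e^{\alpha\Delta t}$. Let $\mathbf{e}_h^n=\Psi^n-\psi_h(t_n)$, where $\psi_h$ is the semi-discrete solution and $\Psi^n$ the solution of the backward Euler scheme with $\Psi^0=\psi_h(0)$. Then there exist positive constants $C=C(t_N)$ and $\beta_1$, independent of $\Delta t$, such that for $n=1,2,\dots,N$ $$\|\nabla\mathbf{e}_h^n\|^2+\beta_1\Delta t\,e^{-2\alpha t_n}\sum_{i=1}^n e^{2\alpha t_i}|\mathbf{e}_h^i|_2^2\leq C(t_N)(\Delta t)^2 .$$
   Context: $\Omega\subset\mathbb{R}^2$ is a bounded domain, $\nu>0$, $\mu>0$ constants, $(\cdot,\cdot)$, $\|\cdot\|$ the $L^2(\Omega)$ inner product and norm, $\langle\cdot,\cdot\rangle$ the $L^2$ inner product or duality pairing, $|\cdot|_2$ the $H^2(\Omega)$ seminorm (on $H^2_0(\Omega)$, $|v|_2=\|\Delta v\|$). $\bar\lambda_1>0$ is the minimum eigenvalue of $-\Delta\phi=\bar\lambda\phi$ in $\Omega$ with homogeneous Dirichlet boundary condition. $F$ is the forcing (taken at time $t_n$ in the fully discrete scheme if time dependent). $\mathcal{T}_h$ is a shape regular partition of $\overline\Omega$; $S_h\subset C^1(\Omega)\cap\mathcal{P}$ is a $C^1$-conforming finite element space of piecewise polynomials ($\mathcal P$ a piecewise polynomial space) of degree up to $k\ge3$, and $S_h^0=\{v\in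 S_h: v=\partial_{\mathbf n}v=0\text{ on }\partial\Omega\}$. Set $a(v,w)=(\Delta v,\Delta w)$, $b_0(v,w)=-\frac12[(v_x,w)-(v,w_x)]$, $b(\psi;v,w)=(\Delta\psi,\,v_yw_x-v_xw_y)$. The semi-discrete solution $\psi_h(t)\in S_h^0$ satisfies $\psi_h(0)=\psi_{0,h}$ and $$(\partial_t\nabla\psi_h,\nabla\chi)+\nu a(\psi_h,\chi)+b(\psi_h;\psi_h,\chi)+\mu b_0(\psi_h,\chi)=\mu(F,\chi)\quad\forall\chi\in S_h^0,$$ and it is assumed that $e^{-2\alpha t}\int_0^t e^{2\alpha s}\|\nabla\partial_t^2\psi_h(s)\|^2\,ds\le C$. With time step $\Delta t$, $t_n=n\Delta t$ and $\overline\partial_t\Psi^n=(\Psi^n-\Psi^{n-1})/\Delta t$, the backward Euler scheme is: $\Psi^0=\psi_{0,h}$ and, for $n=1,\dots,N$, $\Psi^n\in S_h^0$ satisfies $$\langle\nabla\overline\partial_t\Psi^n,\nabla\chi\rangle+\nu a(\Psi^n,\chi)+b(\Psi^n;\Psi^n,\chi)+\mu b_0(\Psi^n,\chi)=\mu\langle F,\chi\rangle\quad\forall\chi\in S_h^0 .$$ *)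

(* Defs.v *)
From HB Require Import structures.
From mathcomp Require Export all_boot all_order all_algebra.
From mathcomp Require Export all_classical all_reals all_analysis.
Set Implicit Arguments.
Unset Strict Implicit.
Unset Printing Implicit Defensive.
Export Order.TTheory GRing.Theory Num.Theory numFieldNormedType.Exports.
Local Open Scope classical_set_scope.
Local Open Scope ring_scope.

Definition dotp (R : realType) (p q : R * R) : R := p.1 * q.1 + p.2 * q.2.

(* The library norm on [R * R] is the sup norm. *)
Definition enorm (R : realType) (p : R * R) : R := Num.sqrt (dotp p p).

Notation area R := ((@lebesgue_measure R) \x (@lebesgue_measure R))%E.

Definition bounded_domain (R : realType) (Omega : set (R * R)) : Prop :=
  [/\ open Omega, connected Omega, Omega !=set0 & bounded_set Omega].

Definition bdry (R : realType) (Omega : set (R * R)) : set (R * R) :=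
  closure Omega `\` Omega°.

(* [n] is the outward unit normal of [Omega] at [p]: near [p], and up to
   directions of arbitrarily small slope, [Omega] is the half plane
   [(q - p) . n < 0].  No such [n] exists at a corner. *)
Definition outward_normal (R : realType) (Omega : set (R * R))
    (p n : R * R) : Prop :=
  enorm n = 1 /\
  forall e : R, 0 < e -> exists2 d : R, 0 < d &
    forall q : R * R, enorm (q - p) < d ->
      (dotp (q - p) n < - (e * enorm (q - p)) -> Omega q) /\
      (e * enorm (q - p) < dotp (q - p) n -> ~ Omega q).

(* Outward normal derivative, as a one-sided limit from inside the domain. *)
Definition normal_derivative_is (R : realType) (v : R * R -> R)
    (p n : R * R) (l : R) : Prop :=
  (v p - v (p - s *: n)) / s @[s --> 0^'+] --> l.

Definition dx (R : realType) (v : R * R -> R) : R * R -> R :=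
  fun p => 'D_((1, 0) : R * R) v p.
Definition dy (R : realType) (v : R * R -> R) : R * R -> R :=
  fun p => 'D_((0, 1) : R * R) v p.
Definition lap (R : realType) (v : R * R -> R) : R * R -> R :=
  fun p => dx (dx v) p + dy (dy v) p.

Definition C1 (R : realType) (Omega : set (R * R)) (v : R * R -> R) : Prop :=
  forall p, Omega p ->
    [/\ derivable v p ((1, 0) : R * R), derivable v p ((0, 1) : R * R),
        {for p, continuous (dx v)} & {for p, continuous (dy v)}].

Definition C2 (R : realType) (Omega : set (R * R)) (v : R * R -> R) : Prop :=
  [/\ C1 Omega v, C1 Omega (dx v) & C1 Omega (dy v)].

Definition dirichlet_eigenvalue (R : realType) (Omega : set (R * R))
    (lam : R) : Prop :=
  exists phi : R * R -> R,
    [/\ C2 Omega phi, {within closure Omega, continuous phi},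
        forall p, bdry Omega p -> phi p = 0,
        exists2 p, Omega p & phi p != 0
      & forall p, Omega p -> - lap phi p = lam * phi p].

Definition min_dirichlet_eigenvalue (R : realType) (Omega : set (R * R))
    (lam : R) : Prop :=
  dirichlet_eigenvalue Omega lam /\
  forall lam', dirichlet_eigenvalue Omega lam' -> lam <= lam'.

(* The second derivatives of a C1 piecewise polynomial may fail to exist on the
   interfaces between elements; the latter have zero area and do not affect
   the integrals below. *)
Definition ip (R : realType) (Omega : set (R * R)) (v w : R * R -> R) : R :=
  Rintegral (area R) Omega (fun p => v p * w p).

Definition ip_grad (R : realType) (Omega : set (R * R))
    (v w : R * R -> R) : R :=
  ip Omega (dx v) (dx w) + ip Omega (dy v) (dy w).

Definition grad_norm (R : realType) (Omega : set (R * R))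
    (v : R * R -> R) : R :=
  Num.sqrt (ip_grad Omega v v).

Definition H2_seminorm (R : realType) (Omega : set (R * R))
    (v : R * R -> R) : R :=
  Num.sqrt (ip Omega (dx (dx v)) (dx (dx v)) +
            2 * ip Omega (dx (dy v)) (dx (dy v)) +
            ip Omega (dy (dy v)) (dy (dy v))).

Definition square_integrable (R : realType) (Omega : set (R * R))
    (f : R * R -> R) : Prop :=
  measurable_fun Omega f /\
  (area R).-integrable Omega (fun p : R * R => (f p ^+ 2)%:E).

Definition form_a (R : realType) (Omega : set (R * R))
    (v w : R * R -> R) : R :=
  ip Omega (lap v) (lap w).

Definition form_b0 (R : realType) (Omega : set (R * R))
    (v w : R * R -> R) : R :=
  - 2^-1 * (ip Omega (dx v) w - ip Omega v (dx w)).

Definition form_b (R : realType) (Omega : set (R * R))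
    (psi v w : R * R -> R) : R :=
  ip Omega (lap psi) (fun p => dy v p * dx w p - dx v p * dy w p).

(* Elements of arbitrary shape: triangles, rectangles, ... *)
Definition partition_of (R : realType) (m : nat) (T : 'I_m -> set (R * R))
    (D : set (R * R)) : Prop :=
  [/\ forall i, compact (T i),
      forall i, (T i)° !=set0,
      forall i, (area R).-negligible (T i `\` (T i)°),
      \bigcup_i T i = D
    & forall i j : 'I_m, i != j -> (T i)° `&` (T j)° = set0].

Definition shape_regular (R : realType) (m : nat) (T : 'I_m -> set (R * R))
    (sigma : R) : Prop :=
  forall i, exists c : R * R, exists2 rho : R, 0 < rho &
    (forall q, enorm (q - c) <= rho -> T i q) /\
    (forall p q, T i p -> T i q -> enorm (p - q) <= sigma * rho).

(* On every closed element, [v] is a polynomial of total degree at most [k]. *)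
Definition piecewise_poly (R : realType) (m : nat) (T : 'I_m -> set (R * R))
    (k : nat) (v : R * R -> R) : Prop :=
  forall i, exists a : nat -> nat -> R, forall p, T i p ->
    v p = \sum_(r < k.+1) \sum_(s < k.+1 | (r + s <= k)%N)
            a r s * p.1 ^+ r * p.2 ^+ s.

(* Elements of the finite element space are functions on the closure of
   [Omega]; their values elsewhere are irrelevant. *)
Definition C1_fe_space (R : realType) (Omega : set (R * R)) (m : nat)
    (T : 'I_m -> set (R * R)) (k : nat) (Sh : set (R * R -> R)) : Prop :=
  [/\ Sh (fun=> 0),
      forall (c : R) v w, Sh v -> Sh w -> Sh (fun p => c * v p + w p)
    & forall v, Sh v -> C1 Omega v /\ piecewise_poly T k v].

Definition clamped (R : realType) (Omega : set (R * R))
    (Sh : set (R * R -> R)) : set (R * R -> R) :=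
  [set v | [/\ Sh v, forall p, bdry Omega p -> v p = 0
             & forall p n, bdry Omega p -> outward_normal Omega p n ->
                 normal_derivative_is v p n 0]].

Definition time_deriv (R : realType) (u : R -> R * R -> R) (t : R) : R * R -> R :=
  fun p => derive1 (fun s => u s p) t.

Definition semidiscrete_solution (R : realType) (Omega : set (R * R))
    (Sh0 : set (R * R -> R)) (nu mu : R) (F : R -> R * R -> R)
    (psi0h : R * R -> R) (psi : R -> R * R -> R) : Prop :=
  [/\ forall t : R, 0 <= t -> Sh0 (psi t),
      forall p, Omega p -> psi 0 p = psi0h p,
      forall p, Omega p -> psi t p @[t --> 0^'+] --> psi 0 p,
      forall (p : R * R) (t : R), Omega p -> 0 < t -> derivable (fun s => psi s p) t 1
    & forall (t : R) (chi : R * R -> R), 0 < t -> Sh0 chi ->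
        ip Omega (time_deriv (fun s => dx (psi s)) t) (dx chi) +
        ip Omega (time_deriv (fun s => dy (psi s)) t) (dy chi) +
        nu * form_a Omega (psi t) chi + form_b Omega (psi t) (psi t) chi +
        mu * form_b0 Omega (psi t) chi = mu * ip Omega (F t) chi].

(* [psi_tt] is the second time derivative of the curve [psi] in [Sh0], in the
   sense that [time_deriv psi] is absolutely continuous with density [psi_tt]; a
   continuous classical second derivative is a particular case. *)
Definition second_time_derivative (R : realType) (Omega : set (R * R))
    (Sh0 : set (R * R -> R)) (psi psi_tt : R -> R * R -> R) : Prop :=
  (forall t : R, 0 < t -> Sh0 (psi_tt t)) /\
  forall (p : R * R) (s t : R), Omega p -> 0 < s -> s <= t ->
    (@lebesgue_measure R).-integrable `[s, t] (fun r : R => (psi_tt r p)%:E) /\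
    time_deriv psi t p - time_deriv psi s p =
      Rintegral (@lebesgue_measure R) `[s, t] (fun r : R => psi_tt r p).

Definition time_node (R : realType) (tau : R) (n : nat) : R := n%:R * tau.

Definition backward_diff (R : realType) (tau : R) (Psi : nat -> R * R -> R)
    (n : nat) : R * R -> R :=
  fun p => (Psi n p - Psi n.-1 p) / tau.

Definition backward_euler_solution (R : realType) (Omega : set (R * R))
    (Sh0 : set (R * R -> R)) (nu mu : R) (F : R -> R * R -> R)
    (psi0h : R * R -> R) (tau : R) (N : nat) (Psi : nat -> R * R -> R) : Prop :=
  [/\ Sh0 (Psi 0%N),
      forall p, Omega p -> Psi 0%N p = psi0h p
    & forall n, (1 <= n <= N)%N -> Sh0 (Psi n) /\
        forall chi, Sh0 chi ->
          ip_grad Omega (backward_diff tau Psi n) chi +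
          nu * form_a Omega (Psi n) chi + form_b Omega (Psi n) (Psi n) chi +
          mu * form_b0 Omega (Psi n) chi =
          mu * ip Omega (F (time_node tau n)) chi].

(* Main.v *)
(* The clamped finite element functions form a finite dimensional space, on which
   the energy inner product is definite: a function without gradient is constant
   on the way to the boundary, where it vanishes.  Hence all the forms, and the H2
   seminorm, are bounded in terms of the energy norm.  Testing the difference of
   the two schemes at time t_n with the error e^n cancels the load and leaves
   b(e^n; psi_h(t_n), e^n) of the trilinear terms, so that E_n = |grad e^n|
   satisfies
     E_n <= E_(n-1) + tau K E_n + tau (V(t_n) - V(t_(n-1))),
   where V bounds the variation of the velocity, which is finite by the
   assumption on the second time derivative.  If tau K <= 1/2, a discrete Gronwall
   argument gives E_n = O(tau); for larger tau the stability of both schemes is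
   enough. *)

(* The constants may depend on the mesh but not on the step, and this decides the method: the
   remaining convection term is bounded by energy norms alone and goes into the Gronwall factor,
   while the diffusion is merely dropped by its sign. Three obstacles shape the rest. Derivatives
   are uncontrolled on the interfaces, so every form is first moved to the element interiors inside
   [Omega]. Continuity up to the boundary is not among the assumptions and has to be extracted from
   the polynomials on the closed elements. Regularity in time is pointwise in space, and the energy
   of [psi_tt] enters through a lower integral, since its measurability in time is unknown; a basis
   dual to finitely many point evaluations reduces it to the scalar functions [psi t (z j)]. At time
   0 only right continuity is known, so V is built from an integral taken backwards from the final
   time. *)
Require Import Defs.
From mathcomp Require Import ring lra measurable_realfun.
Set Implicit Arguments.
Unset Strict Implicit.
Import HBNNSimple.
Local Open Scope classical_set_scope.
Local Open Scope ring_scope.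

(* Second derivatives on the interfaces of elements have junk values that may
   spoil measurability.  They are harmless because the library integral of a
   nonnegative function is the supremum over the simple functions below it. *)
Lemma ge0_le_integralT_off_null d (X : measurableType d) (R : realType)
    (mu : {measure set X -> \bar R}) (N : set X) (f g : X -> \bar R) :
  measurable N -> mu N = 0%E ->
  (forall x, (0 <= f x)%E) -> (forall x, (0 <= g x)%E) ->
  (forall x, ~ N x -> (f x <= g x)%E) ->
  (\int[mu]_x f x <= \int[mu]_x g x)%E.
Proof.
move=> mN N0 f0 g0 fg.
rewrite [leLHS]ge0_integralTE// [leRHS]ge0_integralTE//.
apply: ge_ereal_sup => _ /= [h hf <-].
(* [h'] is [h] set to zero on [N]: the integral is unchanged, and on [N] it lies below [g] because
   [g] is nonnegative. *)
pose h' := mul_nnsfun h (indic_nnsfun R (measurableC mN)).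
have -> : sintegral mu h = sintegral mu h'.
  rewrite -!integralT_nnsfun; apply: ge0_ae_eq_integral => //.
  - by apply/measurable_EFinP.
  - by apply/measurable_EFinP.
  - by move=> x _; rewrite lee_fin.
  - by move=> x _; rewrite lee_fin.
  exists N; split => // x /= xN; apply: contrapT => Nx; apply: xN => _.
  by rewrite /h' /= mindicE mem_set// mulr1.
apply: ereal_sup_ubound => /=; exists h' => // x.
rewrite /h' /= mindicE; case: (asboolP (N x)) => Nx.
  by rewrite memNset ?mulr0//= => /(_ Nx).
by rewrite mem_set// mulr1; exact: le_trans (hf x) (fg x Nx).
Qed.

Lemma ge0_le_integral_off_null d (X : measurableType d) (R : realType)
    (mu : {measure set X -> \bar R}) (N D D' : set X) (f g : X -> \bar R) :
  measurable N -> mu N = 0%E -> D `<=` D' ->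
  (forall x, D x -> (0 <= f x)%E) -> (forall x, D' x -> (0 <= g x)%E) ->
  (forall x, D x -> ~ N x -> (f x <= g x)%E) ->
  (\int[mu]_(x in D) f x <= \int[mu]_(x in D') g x)%E.
Proof.
move=> mN N0 DD' f0 g0 fg; rewrite integral_mkcond [leRHS]integral_mkcond.
apply: (@ge0_le_integralT_off_null _ _ _ mu N) => // x; rewrite /patch.
- by case: ifPn => //; rewrite inE; exact: f0.
- by case: ifPn => //; rewrite inE; exact: g0.
move=> Nx; case: ifPn => [|_]; last by case: ifPn => //; rewrite inE; exact: g0.
by rewrite inE => Dx; rewrite mem_set ?fg//; exact: DD'.
Qed.

(** Positive and negative parts are compared in both directions, so the measurability of the
    integrands never enters. *)
Lemma eq_integral_off_null d (X : measurableType d) (R : realType)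
    (mu : {measure set X -> \bar R}) (N D : set X) (f g : X -> \bar R) :
  measurable N -> mu N = 0%E -> (forall x, D x -> ~ N x -> f x = g x) ->
  (\int[mu]_(x in D) f x = \int[mu]_(x in D) g x)%E.
Proof.
move=> mN N0 fg; rewrite integralE [RHS]integralE; congr (_ - _)%E;
  apply/eqP; rewrite eq_le; apply/andP; split;
  apply: (@ge0_le_integral_off_null _ _ _ mu N) => // x Dx Nx;
  by rewrite ?funeposE ?funenegE fg.
Qed.

(** * Open sets of the plane: measurability and finite area *)

Lemma open_measurable_prod (R : realType) (U : set (R * R)) :
  open U -> measurable U.
Proof.
move=> oU.
(* The sigma-algebra on [R * R] is the product one; an open set is the union of the countably many
   boxes with rational corners that it contains. *)
pose box (q : (rat * rat) * (rat * rat)) : set (R * R) :=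
  `]ratr q.1.1, ratr q.1.2[ `*` `]ratr q.2.1, ratr q.2.2[.
have -> : U = \bigcup_(q in [set q | box q `<=` U]) box q.
  apply/seteqP; split => [p Up|p [q /= qU qp]]; last exact: qU.
  have /nbhs_ballP[e /= e0 eU] : nbhs p U by exact: open_nbhs_nbhs.
  have lo (x : R) : exists q : rat, ratr q \in `]x - e, x[.
    by have [|q qx] := @rat_in_itvoo R (x - e) x; [lra|exists q].
  have hi (x : R) : exists q : rat, ratr q \in `]x, x + e[.
    by have [|q qx] := @rat_in_itvoo R x (x + e); [lra|exists q].
  have [a a1] := lo p.1; have [b b1] := hi p.1.
  have [c c1] := lo p.2; have [d d1] := hi p.2.
  move: a1 b1 c1 d1; rewrite !in_itv /=.
  move=> /andP[a1 a2] /andP[b1 b2] /andP[c1 c2] /andP[d1 d2].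
  exists ((a, b), (c, d)) => /=; last first.
    by split; rewrite /= in_itv /=; apply/andP; split.
  move=> q [/=]; rewrite !in_itv /= => /andP[q1 q2] /andP[q3 q4].
  by apply: eU; split; rewrite /ball /= ltr_norml; apply/andP; split; lra.
rewrite bigcup_mkcond; apply: countable_bigcupT_measurable => [|q].
  exact: countableP.
by case: ifP => _ //; apply: measurableX; exact: measurable_itv.
Qed.

Lemma area_bounded_lt_pinfty (R : realType) (U : set (R * R)) :
  open U -> bounded_set U -> (area R U < +oo)%E.
Proof.
move=> oU [M [_ bU]].
pose K := `|M| + 1.
have MK : M < K by rewrite /K; have := ler_norm M; lra.
have K0 : 0 <= K by rewrite /K; have := normr_ge0 M; lra.
apply: (@le_lt_trans _ _ (area R (`[- K, K] `*` `[- K, K]))).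
  apply: le_measure; rewrite ?inE.
  - exact: open_measurable_prod.
  - by apply: measurableX; exact: measurable_itv.
  move=> p /(bU K MK);
  rewrite /= prod_normE ge_max => /andP[p1 p2].
  by split => /=; rewrite in_itv /= -ler_norml.
rewrite product_measure1E//; [|exact: measurable_itv..].
rewrite -[X in (X < _)%E]/((lebesgue_measure `[(- K)%R, K]%classic *
  lebesgue_measure `[(- K)%R, K]%classic)%E).
rewrite !lebesgue_measure_itv /=.
by case: ifP => _; rewrite -?EFinM ?ltry// mule0 ltry.
Qed.

(** * Piecewise polynomial functions *)

(** Generation instead of coefficients: continuity, measurability, boundedness on bounded sets and
    stability under directional derivatives each become a short induction. *)
Inductive polyfun (R : realType) : (R * R -> R) -> Prop :=
| polyfun_cst c : polyfun (fun=> c)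
| polyfun_fst : polyfun fst
| polyfun_snd : polyfun snd
| polyfunD f g : polyfun f -> polyfun g -> polyfun (f \+ g)
| polyfunM f g : polyfun f -> polyfun g -> polyfun (f \* g).

Lemma polyfun_sum (R : realType) n (Q : pred nat) (f : nat -> R * R -> R) :
  (forall i, polyfun (f i)) -> polyfun (fun p => \sum_(i < n | Q i) f i p).
Proof.
move=> pf; elim: n => [|n IH].
  by under eq_fun do rewrite big_ord0; exact: polyfun_cst.
under eq_fun do rewrite big_mkcond big_ord_recr -big_mkcond /=.
apply: (polyfunD IH); case: (Q n); [exact: pf|exact: polyfun_cst].
Qed.

Lemma polyfunX (R : realType) (f : R * R -> R) n :
  polyfun f -> polyfun (fun p => f p ^+ n).
Proof.
move=> pf; elim: n => [|n IH].
  by under eq_fun do rewrite expr0; exact: polyfun_cst.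
by under eq_fun do rewrite exprS; exact: polyfunM.
Qed.

Lemma polyfun_continuous (R : realType) (f : R * R -> R) :
  polyfun f -> continuous f.
Proof.
elim=> [c|||g h _ cg _ ch|g h _ cg _ ch] p.
- exact: cvg_cst.
- exact: cvg_fst.
- exact: cvg_snd.
- by apply: cvgD; [exact: cg|exact: ch].
- by apply: cvgM; [exact: cg|exact: ch].
Qed.

Lemma polyfun_measurable (R : realType) (f : R * R -> R) D :
  polyfun f -> measurable D -> measurable_fun D f.
Proof.
move=> + mD; elim=> [c|||g h _ mg _ mh|g h _ mg _ mh].
- exact: measurable_cst.
- by apply: (measurable_funS measurableT) => //; exact: measurable_fst.
- by apply: (measurable_funS measurableT) => //; exact: measurable_snd.
- exact: measurable_funD.
- exact: measurable_funM.
Qed.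

Lemma polyfun_bounded (R : realType) (f : R * R -> R) (U : set (R * R)) :
  polyfun f -> bounded_set U ->
  exists2 K : R, 0 <= K & forall p, U p -> `|f p| <= K.
Proof.
move=> pf [M [_ bU]].
have M1 : M < `|M| + 1 by have := ler_norm M; lra.
have M0 : 0 <= `|M| + 1 by have := normr_ge0 M; lra.
elim: pf => [c|||g h _ [K K0 gK] _ [L L0 hL]|g h _ [K K0 gK] _ [L L0 hL]].
- by exists `|c|.
- exists (`|M| + 1) => // p /(bU _ M1).
  by rewrite /= prod_normE ge_max => /andP[].
- exists (`|M| + 1) => // p /(bU _ M1).
  by rewrite /= prod_normE ge_max => /andP[].
- exists (K + L) => [|p Up]; first exact: addr_ge0.
  by rewrite (le_trans (ler_normD _ _))// lerD ?gK ?hL.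
- exists (K * L) => [|p Up]; first exact: mulr_ge0.
  by rewrite normrM ler_pM ?gK ?hL.
Qed.

Lemma polyfun_derive (R : realType) (f : R * R -> R) (v : R * R) :
  polyfun f -> exists2 f' : R * R -> R, polyfun f' &
    forall p, is_derive p v f (f' p).
Proof.
elim=> [c|||g h pg [g' pg' dg] ph [h' ph' dh]|g h pg [g' pg' dg] ph [h' ph' dh]].
- by exists (cst 0) => [|p]; [exact: polyfun_cst|exact: is_derive_cst].
- exists (cst v.1) => [|p]; first exact: polyfun_cst.
  have cf : continuous (fst : R * R -> R) by move=> q; exact: cvg_fst.
  apply: DeriveDef; first by apply: diff_derivable; exact: linear_differentiable.
  rewrite deriveE; first by rewrite (diff_lin _ cf).
  exact: linear_differentiable.
- exists (cst v.2) => [|p]; first exact: polyfun_cst.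
  have cf : continuous (snd : R * R -> R) by move=> q; exact: cvg_snd.
  apply: DeriveDef; first by apply: diff_derivable; exact: linear_differentiable.
  rewrite deriveE; first by rewrite (diff_lin _ cf).
  exact: linear_differentiable.
- exists (g' \+ h') => [|p]; first exact: polyfunD.
  exact: is_deriveD.
- exists ((g \* h') \+ (h \* g')) => [|p].
    by apply: polyfunD; exact: polyfunM.
  exact: is_deriveM.
Qed.

Section Mesh.
Variables (R : realType) (Omega : set (R * R)) (m : nat).
Variable T : 'I_m -> set (R * R).

(** The part of [Omega] where derivatives of piecewise polynomials are genuine; it misses only a
    null set. *)
Definition mesh_interior : set (R * R) := Omega `&` \bigcup_i (T i)°.

(** Unlike in [piecewise_poly], elements are open and the degree is free: this makes the class
    stable under products and under [dx], [dy], whose values on an interface are uncontrolled. *)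
Definition pwpoly (f : R * R -> R) : Prop :=
  forall i, exists2 P, polyfun P & forall p, (T i)° p -> f p = P p.

Lemma pwpoly_cst (c : R) : pwpoly (fun=> c).
Proof. by move=> i; exists (fun=> c) => //; exact: polyfun_cst. Qed.

Lemma pwpolyD f g : pwpoly f -> pwpoly g -> pwpoly (fun p => f p + g p).
Proof.
move=> pf pg i; have [P pP fP] := pf i; have [Q pQ gQ] := pg i.
by exists (P \+ Q) => [|p Tp]; [exact: polyfunD|rewrite fP ?gQ].
Qed.

Lemma pwpolyM f g : pwpoly f -> pwpoly g -> pwpoly (fun p => f p * g p).
Proof.
move=> pf pg i; have [P pP fP] := pf i; have [Q pQ gQ] := pg i.
by exists (P \* Q) => [|p Tp]; [exact: polyfunM|rewrite fP ?gQ].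
Qed.

Lemma pwpolyZ (c : R) f : pwpoly f -> pwpoly (fun p => c * f p).
Proof. by apply: pwpolyM; exact: pwpoly_cst. Qed.

Lemma pwpolyB f g : pwpoly f -> pwpoly g -> pwpoly (fun p => f p - g p).
Proof.
move=> pf pg; under eq_fun do rewrite -mulN1r.
by apply: pwpolyD => //; exact: pwpolyZ.
Qed.

Lemma piecewise_poly_polyfun k f : piecewise_poly T k f ->
  forall i, exists2 P, polyfun P & forall p, T i p -> f p = P p.
Proof.
move=> + i => /(_ i)[a fa].
exists (fun p => \sum_(r < k.+1) \sum_(s < k.+1 | (r + s <= k)%N)
            a r s * p.1 ^+ r * p.2 ^+ s); last exact: fa.
apply: (@polyfun_sum _ _ xpredT (fun r p => \sum_(s < k.+1 | (r + s <= k)%N)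
   a r s * p.1 ^+ r * p.2 ^+ s)) => r.
apply: (@polyfun_sum _ _ (fun s => (r + s <= k)%N)
  (fun s p => a r s * p.1 ^+ r * p.2 ^+ s)) => s.
apply: (@polyfunM _ (fun p => a r s * p.1 ^+ r) (fun p => p.2 ^+ s)).
  apply: (@polyfunM _ (fun p => a r s) (fun p => p.1 ^+ r)).
    exact: polyfun_cst.
  by apply: polyfunX; exact: polyfun_fst.
by apply: polyfunX; exact: polyfun_snd.
Qed.

Lemma piecewise_poly_pwpoly k f : piecewise_poly T k f -> pwpoly f.
Proof.
move=> + i => /piecewise_poly_polyfun/(_ i)[P pP fP].
by exists P => // p /interior_subset; exact: fP.
Qed.

Lemma near_interior (A : set (R * R)) (f g : R * R -> R) p :
  A° p -> (forall q, A° q -> f q = g q) -> \forall q \near p, f q = g q.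
Proof.
move=> Ap fg; near=> q; apply: fg; near: q.
by apply: open_nbhs_nbhs; split => //; exact: open_interior.
Unshelve. all: by end_near. Qed.

Lemma pwpoly_is_derive f (v : R * R) i p : pwpoly f -> (T i)° p ->
  is_derive p v f ('D_v f p).
Proof.
move=> /(_ i)[P pP fP] Tp; have [P' pP' dP] := polyfun_derive v pP.
apply: DeriveDef => //.
apply: (near_eq_derivable (f := P)); last by have := dP p; case.
by apply: near_interior Tp _ => q Tq; rewrite fP.
Qed.

Lemma pwpoly_derive f (v : R * R) : pwpoly f -> pwpoly (fun p => 'D_v f p).
Proof.
move=> pf i; have [P pP fP] := pf i.
have [P' pP' dP] := polyfun_derive v pP; exists P' => // p Tp.
have [_ <-] := dP p.
by apply: near_eq_derive; exact: near_interior Tp fP.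
Qed.

Lemma pwpoly_bounded f : bounded_set Omega -> pwpoly f ->
  exists2 K : R, 0 <= K & forall p, mesh_interior p -> `|f p| <= K.
Proof.
move=> bU pf.
have /choice[K Kf] i : exists K, 0 <= K /\
    forall p, mesh_interior p -> (T i)° p -> `|f p| <= K.
  have [P pP fP] := pf i; have [K K0 PK] := polyfun_bounded pP bU.
  by exists K; split => // p [Up _] Tp; rewrite fP ?PK.
exists (\sum_i K i) => [|p pE].
  by apply: sumr_ge0 => i _; have [] := Kf i.
have [Up [i _ Tp]] := pE; have [_ Ki] := Kf i.
apply: (le_trans (Ki _ pE Tp)); rewrite (bigD1 i)//= lerDl.
by apply: sumr_ge0 => j _; have [] := Kf j.
Qed.

Lemma mesh_interior_null : partition_of T (closure Omega) ->
  exists N, [/\ measurable N, area R N = 0%E &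
    forall p, Omega p -> ~ N p -> mesh_interior p].
Proof.
move=> [_ _ negT covT _].
(* [insub] pads the finite family with empty sets to a sequence indexed by [nat]. *)
pose B (j : nat) : set (R * R) :=
  if insub j is Some i then T i `\` (T i)° else set0.
have [N [mN N0 BN]] : (area R).-negligible (\bigcup_j B j).
  apply: negligible_bigcup => j; rewrite /B; case: insubP => [i _ _|_] //.
  exact: negligible_set0.
exists N; split => // p Up Np; split => //.
have : closure Omega p by exact: subset_closure.
rewrite -covT => -[i _ Tp]; exists i => //; apply: contrapT => nTp.
by apply/Np/BN; exists (i : nat) => //; rewrite /B valK.
Qed.

Hypothesis oU : open Omega.
Hypothesis bU : bounded_set Omega.
Hypothesis pT : partition_of T (closure Omega).

Let E := mesh_interior.

Lemma mesh_interior_open : open E.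
Proof.
by apply: openI => //; apply: bigcup_open => i _; exact: open_interior.
Qed.

Lemma mesh_interior_measurable : measurable E.
Proof. exact: open_measurable_prod mesh_interior_open. Qed.

(** Removes the junk values from all forms at once: [f] is arbitrary on the interfaces, and the new
    domain is open and carries bounded measurable integrands. *)
Lemma eq_integral_mesh (f g : R * R -> \bar R) : {in E, f =1 g} ->
  (\int[area R]_(x in Omega) f x = \int[area R]_(x in E) g x)%E.
Proof.
move=> fg; have -> : E = Omega `&` E by rewrite setIA setIid.
rewrite integral_mkcondr.
have [N [mN N0 EN]] := mesh_interior_null pT.
apply: (@eq_integral_off_null _ _ _ (area R) N) => // p Up Np.
by rewrite patchE mem_set ?fg ?inE//; exact: EN.
Qed.

Lemma eq_Rintegral_mesh (f g : R * R -> R) : {in E, f =1 g} ->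
  Rintegral (area R) Omega f = Rintegral (area R) E g.
Proof.
move=> fg; rewrite /Rintegral; congr fine.
by apply: eq_integral_mesh => p /fg ->.
Qed.

Lemma pwpoly_integrable f : pwpoly f ->
  (area R).-integrable E (EFin \o f).
Proof.
move=> pf; apply: measurable_bounded_integrable.
- exact: mesh_interior_measurable.
- apply: le_lt_trans (area_bounded_lt_pinfty oU bU).
  apply: le_measure; rewrite ?inE; [exact: mesh_interior_measurable| |].
    exact: open_measurable_prod.
  by move=> p [].
- pose B (j : nat) : set (R * R) :=
    if insub j is Some i then Omega `&` (T i)° else set0.
  have -> : E = \bigcup_j B j.
    apply/seteqP; split => [p [Up [i _ Tp]]|p [j _]].
      by exists (i : nat) => //; rewrite /B valK.
    by rewrite /B; case: insubP => // i _ _ [Up Tp]; split => //; exists i.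
  have mT i : measurable (Omega `&` (T i)°).
    by apply: open_measurable_prod; apply: openI => //; exact: open_interior.
  have mB j : measurable (B j) by rewrite /B; case: insubP.
  apply/(measurable_fun_bigcup _ mB) => j; rewrite /B; case: insubP => [i _ _|_];
    last exact: measurable_fun_set0.
  have [P pP fP] := pf i; apply: (eq_measurable_fun P).
    by move=> p; rewrite inE => -[_ Tp]; rewrite fP.
  exact: polyfun_measurable.
- have [K K0 fK] := pwpoly_bounded bU pf.
  exists K; split; first exact: num_real.
  by move=> x Kx p Ep /=; rewrite (le_trans (fK _ Ep))// ltW.
Qed.

End Mesh.

(** * The bilinear and trilinear forms *)

Definition mesh_integral (R : realType) (Omega : set (R * R)) (m : nat)
    (T : 'I_m -> set (R * R)) (f : R * R -> R) : R :=
  Rintegral (area R) (mesh_interior Omega T) f.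

Lemma pwpoly_dx (R : realType) (m : nat) (T : 'I_m -> set (R * R)) f :
  pwpoly T f -> pwpoly T (dx f).
Proof. exact: pwpoly_derive. Qed.

Lemma pwpoly_dy (R : realType) (m : nat) (T : 'I_m -> set (R * R)) f :
  pwpoly T f -> pwpoly T (dy f).
Proof. exact: pwpoly_derive. Qed.

Lemma pwpoly_lap (R : realType) (m : nat) (T : 'I_m -> set (R * R)) f :
  pwpoly T f -> pwpoly T (lap f).
Proof.
by move=> pf; apply: pwpolyD; [do 2 apply: pwpoly_dx | do 2 apply: pwpoly_dy].
Qed.

Section Forms.
Variables (R : realType) (Omega : set (R * R)) (m : nat).
Variable T : 'I_m -> set (R * R).
Implicit Types f g u v w psi : R * R -> R.
Hypothesis oU : open Omega.
Hypothesis bU : bounded_set Omega.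
Hypothesis pT : partition_of T (closure Omega).

Local Notation E := (mesh_interior Omega T).
Local Notation J := (mesh_integral Omega T).

Local Notation pw := (pwpoly T).
Local Notation mesh_area := (fine (area R E)).

Let mE : measurable E. Proof. exact: mesh_interior_measurable. Qed.

Lemma mesh_integralZ (c : R) f : pw f -> J (fun p => c * f p) = c * J f.
Proof. by move=> pf; apply: RintegralZl => //; exact: pwpoly_integrable. Qed.

Lemma mesh_integralD f g : pw f -> pw g -> J (fun p => f p + g p) = J f + J g.
Proof. by move=> pf pg; apply: RintegralD => //; exact: pwpoly_integrable. Qed.

Lemma mesh_integralB f g : pw f -> pw g -> J (fun p => f p - g p) = J f - J g.
Proof. by move=> pf pg; apply: RintegralB => //; exact: pwpoly_integrable. Qed.

Lemma eq_mesh_integral f g : (forall p, E p -> f p = g p) -> J f = J g.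
Proof.
by move=> fg; rewrite /mesh_integral /Rintegral; congr fine; apply: eq_integral => p;
  rewrite inE => /fg ->.
Qed.

Lemma normr_mesh_integral f (K : R) : pw f -> (forall p, E p -> `|f p| <= K) ->
  `|J f| <= K * mesh_area.
Proof.
move=> pf fK.
have JK (c : R) : J (fun=> c) = c * mesh_area.
  by rewrite /mesh_integral Rintegral_cst.
have ic c := pwpoly_integrable oU bU (pwpoly_cst T c).
have iF := pwpoly_integrable oU bU pf.
rewrite ler_norml -mulNr -!JK; apply/andP; split.
  apply: le_Rintegral => //.
  by move=> p /fK; rewrite ler_norml => /andP[].
apply: le_Rintegral => //.
by move=> p /fK; rewrite ler_norml => /andP[].
Qed.

Lemma ip_mesh_integral v w : ip Omega v w = J (fun p => v p * w p).
Proof. exact: (eq_Rintegral_mesh pT). Qed.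

Lemma derive_lin_mesh (d : R * R) (c : R) f g : pw f -> pw g ->
  forall i p, (T i)° p ->
    'D_d (fun q => c * f q + g q) p = c * 'D_d f p + 'D_d g p.
Proof.
move=> pf pg i p Tp.
have [df _] := pwpoly_is_derive d pf Tp; have [dg _] := pwpoly_is_derive d pg Tp.
have dcf : derivable (cst c * f) p d.
  by apply: derivableM; [exact: derivable_cst|exact: df].
have e : 'D_d (cst c * f) p = c * 'D_d f p.
  rewrite deriveM; [|exact: derivable_cst|exact: df].
  by rewrite derive_cst scaler0 addr0.
by have := deriveD dcf dg; rewrite e.
Qed.

Lemma derive2_lin_mesh (d d' : R * R) (c : R) f g : pw f -> pw g ->
  forall i p, (T i)° p ->
    'D_d' (fun r => 'D_d (fun q => c * f q + g q) r) p =
    c * 'D_d' (fun r => 'D_d f r) p + 'D_d' (fun r => 'D_d g r) p.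
Proof.
move=> pf pg i p Tp.
rewrite -(derive_lin_mesh d' c (pwpoly_derive d pf) (pwpoly_derive d pg) Tp).
by apply: near_eq_derive; apply: near_interior Tp _ => q; exact: derive_lin_mesh.
Qed.

Lemma eq_derive_mesh (d : R * R) f g : {in E, f =1 g} ->
  forall p, E p -> 'D_d f p = 'D_d g p.
Proof.
move=> fg p Ep; apply: near_eq_derive; near=> q; apply: fg; rewrite inE.
near: q; apply: open_nbhs_nbhs; split => //.
exact: mesh_interior_open.
Unshelve. all: by end_near. Qed.

Lemma dx_lin (c : R) f g p : pw f -> pw g -> E p ->
  dx (fun q => c * f q + g q) p = c * dx f p + dx g p.
Proof. by move=> pf pg [_ [i _ Tp]]; exact: (derive_lin_mesh (1, 0) c pf pg Tp). Qed.

Lemma dy_lin (c : R) f g p : pw f -> pw g -> E p ->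
  dy (fun q => c * f q + g q) p = c * dy f p + dy g p.
Proof. by move=> pf pg [_ [i _ Tp]]; exact: (derive_lin_mesh (0, 1) c pf pg Tp). Qed.

Lemma dxx_lin (c : R) f g p : pw f -> pw g -> E p ->
  dx (dx (fun q => c * f q + g q)) p = c * dx (dx f) p + dx (dx g) p.
Proof.
by move=> pf pg [_ [i _ Tp]]; exact: (derive2_lin_mesh (1, 0) (1, 0) c pf pg Tp).
Qed.

Lemma dxy_lin (c : R) f g p : pw f -> pw g -> E p ->
  dx (dy (fun q => c * f q + g q)) p = c * dx (dy f) p + dx (dy g) p.
Proof.
by move=> pf pg [_ [i _ Tp]]; exact: (derive2_lin_mesh (0, 1) (1, 0) c pf pg Tp).
Qed.

Lemma dyy_lin (c : R) f g p : pw f -> pw g -> E p ->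
  dy (dy (fun q => c * f q + g q)) p = c * dy (dy f) p + dy (dy g) p.
Proof.
by move=> pf pg [_ [i _ Tp]]; exact: (derive2_lin_mesh (0, 1) (0, 1) c pf pg Tp).
Qed.

Lemma lap_lin (c : R) f g p : pw f -> pw g -> E p ->
  lap (fun q => c * f q + g q) p = c * lap f p + lap g p.
Proof.
move=> pf pg Ep; rewrite -[LHS]/(dx (dx _) p + dy (dy _) p).
by rewrite (dxx_lin c pf pg Ep) (dyy_lin c pf pg Ep) addrACA -mulrDr.
Qed.

Lemma ipC v w : ip Omega v w = ip Omega w v.
Proof. by congr Rintegral; apply/funext => p; rewrite mulrC. Qed.

Lemma ip_ge0 v : 0 <= ip Omega v v.
Proof. by apply: Rintegral_ge0 => p _; rewrite -expr2 sqr_ge0. Qed.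

Lemma eq_ip v w v' w' : (forall p, E p -> v p = v' p) ->
  (forall p, E p -> w p = w' p) -> ip Omega v w = ip Omega v' w'.
Proof.
move=> vv ww; rewrite !ip_mesh_integral; apply: eq_mesh_integral => p Ep.
by rewrite vv ?ww.
Qed.

Lemma ip_linl (c : R) f g h w : pw g -> pw h -> pw w ->
  (forall p, E p -> f p = c * g p + h p) ->
  ip Omega f w = c * ip Omega g w + ip Omega h w.
Proof.
move=> pg ph pw_ fE.
rewrite !ip_mesh_integral -mesh_integralZ; last exact: pwpolyM.
rewrite -mesh_integralD; [|exact/pwpolyZ/pwpolyM|exact: pwpolyM].
by apply: eq_mesh_integral => p Ep; rewrite fE// mulrDl mulrA.
Qed.

Lemma ip_le v w (M N : R) : pw v -> pw w ->
  (forall p, E p -> `|v p| <= M) -> (forall p, E p -> `|w p| <= N) ->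
  `|ip Omega v w| <= M * N * mesh_area.
Proof.
move=> pv pw_ vM wN; rewrite ip_mesh_integral.
apply: normr_mesh_integral => [|p Ep]; first exact: pwpolyM.
by rewrite normrM ler_pM// ?vM ?wN.
Qed.

(* The terms that are quadratic in the error cancel because
   [form_b] is antisymmetric in its last two arguments. *)
Lemma ip_convection_error (l l' d ux uy vx vy ex ey : R * R -> R) :
  pw l -> pw l' -> pw d -> pw ux -> pw uy -> pw vx -> pw vy -> pw ex -> pw ey ->
  (forall p, E p -> d p = -1 * l' p + l p) ->
  (forall p, E p -> ex p = -1 * vx p + ux p) ->
  (forall p, E p -> ey p = -1 * vy p + uy p) ->
  ip Omega l (fun p => uy p * ex p - ux p * ey p) -
  ip Omega l' (fun p => vy p * ex p - vx p * ey p) =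
  ip Omega d (fun p => vy p * ex p - vx p * ey p).
Proof.
move=> pl pl' pd pux puy pvx pvy pex pey dE exE eyE.
rewrite !ip_mesh_integral -mesh_integralB.
- by apply: eq_mesh_integral => p Ep; rewrite dE// exE// eyE//; ring.
- by apply: pwpolyM => //; apply: pwpolyB; exact: pwpolyM.
- by apply: pwpolyM => //; apply: pwpolyB; exact: pwpolyM.
Qed.

Lemma ip_grad_linl (c : R) u v w : pw u -> pw v -> pw w ->
  ip_grad Omega (fun p => c * u p + v p) w =
  c * ip_grad Omega u w + ip_grad Omega v w.
Proof.
move=> pu pv pw_.
have hx := ip_linl (pwpoly_dx pu) (pwpoly_dx pv) (pwpoly_dx pw_)
  (fun p => dx_lin c pu pv (p := p)).
have hy := ip_linl (pwpoly_dy pu) (pwpoly_dy pv) (pwpoly_dy pw_)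
  (fun p => dy_lin c pu pv (p := p)).
by rewrite /ip_grad hx hy addrACA -mulrDr.
Qed.

Lemma ip_gradC v w : ip_grad Omega v w = ip_grad Omega w v.
Proof. by rewrite /ip_grad [ip _ (dx v) _]ipC [ip _ (dy v) _]ipC. Qed.

Lemma eq_ip_gradl u v w : {in E, u =1 v} ->
  ip_grad Omega u w = ip_grad Omega v w.
Proof.
move=> uv.
have hx : ip Omega (dx u) (dx w) = ip Omega (dx v) (dx w).
  by apply: eq_ip; [exact: eq_derive_mesh uv|].
have hy : ip Omega (dy u) (dy w) = ip Omega (dy v) (dy w).
  by apply: eq_ip; [exact: eq_derive_mesh uv|].
by rewrite /ip_grad hx hy.
Qed.

Lemma ip_grad_ge0 v : 0 <= ip_grad Omega v v.
Proof. exact: addr_ge0 (ip_ge0 _) (ip_ge0 _). Qed.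

Lemma form_a_ge0 v : 0 <= form_a Omega v v.
Proof. exact: ip_ge0. Qed.

Lemma form_a_linl (c : R) u v w : pw u -> pw v -> pw w ->
  form_a Omega (fun p => c * u p + v p) w =
  c * form_a Omega u w + form_a Omega v w.
Proof.
move=> pu pv pw_.
exact: (ip_linl (pwpoly_lap pu) (pwpoly_lap pv) (pwpoly_lap pw_)
  (fun p => lap_lin c pu pv (p := p))).
Qed.

Lemma form_b0_self v : form_b0 Omega v v = 0.
Proof. by rewrite /form_b0 [ip Omega v _]ipC subrr mulr0. Qed.

Lemma form_b0_linl (c : R) u v w : pw u -> pw v -> pw w ->
  form_b0 Omega (fun p => c * u p + v p) w =
  c * form_b0 Omega u w + form_b0 Omega v w.
Proof.
move=> pu pv pw_.
have h1 := ip_linl (pwpoly_dx pu) (pwpoly_dx pv) pw_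
  (fun p => dx_lin c pu pv (p := p)).
have h2 := @ip_linl c _ u v (dx w) pu pv (pwpoly_dx pw_) (fun p _ => erefl).
rewrite /form_b0 h1 h2.
move: (ip Omega (dx u) w) (ip Omega (dx v) w) (ip Omega u (dx w))
  (ip Omega v (dx w)) => X Y Z W.
by ring.
Qed.

Lemma form_b_self psi v : form_b Omega psi v v = 0.
Proof.
rewrite /form_b /ip /Rintegral (eq_integral (cst 0%E)) ?integral0// => p _.
by rewrite (mulrC (dy v p)) subrr mulr0.
Qed.

(** The middle argument left on the right is [v]. With [v] the semi-discrete solution, the
    coefficient of the quadratic term in [e] is bounded independently of the time step. *)
Lemma form_b_error u v : pw u -> pw v ->
  let e := fun p => -1 * v p + u p in
  form_b Omega u u e - form_b Omega v v e = form_b Omega e v e.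
Proof.
move=> pu pv e.
have pe : pw e by apply: pwpolyD => //; exact: pwpolyZ.
exact: (ip_convection_error (pwpoly_lap pu) (pwpoly_lap pv) (pwpoly_lap pe)
  (pwpoly_dx pu) (pwpoly_dy pu) (pwpoly_dx pv) (pwpoly_dy pv)
  (pwpoly_dx pe) (pwpoly_dy pe)
  (fun p => lap_lin (-1) pv pu (p := p))
  (fun p => dx_lin (-1) pv pu (p := p)) (fun p => dy_lin (-1) pv pu (p := p))).
Qed.

End Forms.

(** * Cauchy-Schwarz for semidefinite forms *)

Section CauchySchwarz.
Variables (R : realType) (X : Type) (S : (X -> R) -> Prop).
Variable B : (X -> R) -> (X -> R) -> R.
Hypothesis S_lin : forall c v w, S v -> S w -> S (fun p => c * v p + w p).
Hypothesis B_linl : forall c u v w, S u -> S v -> S w ->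
  B (fun p => c * u p + v p) w = c * B u w + B v w.
Hypothesis B_sym : forall v w, B v w = B w v.
Hypothesis B_ge0 : forall v, 0 <= B v v.

Lemma cauchy_schwarz v w : S v -> S w ->
  `|B v w| <= Num.sqrt (B v v) * Num.sqrt (B w w).
Proof.
move=> Sv Sw; rewrite -sqrtr_sqr -sqrtrM ?B_ge0// ler_wsqrtr//.
have q t : 0 <= t * (t * B v v + B v w) + (t * B v w + B w w).
  suff <- : B (fun p => t * v p + w p) (fun p => t * v p + w p) =
      t * (t * B v v + B v w) + (t * B v w + B w w) by exact: B_ge0.
  have St := S_lin t Sv Sw.
  rewrite B_linl// [B v _]B_sym [B w (fun _ => _)]B_sym !B_linl//.
  by rewrite [B w v]B_sym.
have := B_ge0 v; have := B_ge0 w.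
move: (B v v) (B v w) (B w w) q => a b c q c0; rewrite le_eqVlt => /predU1P[a0|a0].
  have [->|b0] := eqVneq b 0; first by rewrite -a0; lra.
  (* When [B v v] vanishes the quadratic degenerates to 2bt + c; this argument gives it the value
     -1, which contradicts its sign. *)
  have := q (- (c + 1) / (2 * b)); rewrite -a0.
  have -> : - (c + 1) / (2 * b) * (- (c + 1) / (2 * b) * 0 + b) +
      (- (c + 1) / (2 * b) * b + c) = -1 by field; rewrite b0.
  by lra.
have := q (- b / a).
have -> : - b / a * (- b / a * a + b) + (- b / a * b + c) = (a * c - b ^+ 2) / a.
  by field; lra.
by rewrite pmulr_lge0 ?invr_gt0// subr_ge0.
Qed.

End CauchySchwarz.

(** * Bounds of the forms by pointwise bounds on the mesh interior *)

Section Bounds.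
Variables (R : realType) (Omega : set (R * R)) (m : nat).
Variable T : 'I_m -> set (R * R).
Implicit Types f g u v w psi : R * R -> R.
Hypothesis oU : open Omega.
Hypothesis bU : bounded_set Omega.
Hypothesis pT : partition_of T (closure Omega).

Local Notation E := (mesh_interior Omega T).
Local Notation pw := (pwpoly T).
Local Notation mesh_area := (fine (area R E)).

(** A crude C2 bound through which every form and the H2 seminorm are estimated; on the finite
    element space it is later dominated by the energy norm. *)
Definition mesh_bound v (M : R) := forall p, E p ->
  [/\ `|v p| <= M, `|dx v p| <= M, `|dy v p| <= M &
    [/\ `|dx (dx v) p| <= M, `|dx (dy v) p| <= M & `|dy (dy v) p| <= M]].

Lemma pwpoly_mesh_bound v : pw v -> exists2 M : R, 0 <= M & mesh_bound v M.
Proof.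
move=> pv.
have [M0 M00 h0] := pwpoly_bounded bU pv.
have [M1 M10 h1] := pwpoly_bounded bU (pwpoly_dx pv).
have [M2 M20 h2] := pwpoly_bounded bU (pwpoly_dy pv).
have [M3 M30 h3] := pwpoly_bounded bU (pwpoly_dx (pwpoly_dx pv)).
have [M4 M40 h4] := pwpoly_bounded bU (pwpoly_dx (pwpoly_dy pv)).
have [M5 M50 h5] := pwpoly_bounded bU (pwpoly_dy (pwpoly_dy pv)).
exists (M0 + M1 + M2 + M3 + M4 + M5) => [|p Ep]; first by lra.
split; [apply: le_trans (h0 p Ep) _ | apply: le_trans (h1 p Ep) _
  | apply: le_trans (h2 p Ep) _ | split; [apply: le_trans (h3 p Ep) _
  | apply: le_trans (h4 p Ep) _ | apply: le_trans (h5 p Ep) _]];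
  clear -M00 M10 M20 M30 M40 M50; lra.
Qed.

Lemma mesh_bound_lin (c : R) f g M N : pw f -> pw g ->
  mesh_bound f M -> mesh_bound g N ->
  mesh_bound (fun p => c * f p + g p) (`|c| * M + N).
Proof.
move=> pf pg hM hN p Ep.
have key (x y z : R) : z = c * x + y -> `|x| <= M -> `|y| <= N ->
    `|z| <= `|c| * M + N.
  move=> -> xM yN; rewrite (le_trans (ler_normD _ _))// lerD// normrM.
  by rewrite ler_wpM2l.
have [f0 f1 f2 [f3 f4 f5]] := hM p Ep.
have [g0 g1 g2 [g3 g4 g5]] := hN p Ep.
split; [exact: key erefl f0 g0 | exact: key (dx_lin c pf pg Ep) f1 g1
  | exact: key (dy_lin c pf pg Ep) f2 g2 |].
split; [exact: key (dxx_lin c pf pg Ep) f3 g3 |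
  exact: key (dxy_lin c pf pg Ep) f4 g4 |
  exact: key (dyy_lin c pf pg Ep) f5 g5].
Qed.

Lemma mesh_bound0 : mesh_bound (fun=> 0) 0.
Proof.
have d0 (d : R * R) : (fun p : R * R => 'D_d (fun=> 0 : R) p) = (fun=> 0 : R).
  by apply/funext => p; exact: derive_cst.
have dx0 : dx (fun=> 0 : R) = (fun=> 0) by exact: d0.
have dy0 : dy (fun=> 0 : R) = (fun=> 0) by exact: d0.
by move=> p _; rewrite !(dx0, dy0) normr0; split.
Qed.

Lemma mesh_bound_sum (I : Type) (s : seq I) (c : I -> R) (phi : I -> R * R -> R)
    (M : I -> R) :
  (forall i, pw (phi i)) -> (forall i, mesh_bound (phi i) (M i)) ->
  pw (fun p => \sum_(i <- s) c i * phi i p) /\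
  mesh_bound (fun p => \sum_(i <- s) c i * phi i p) (\sum_(i <- s) `|c i| * M i).
Proof.
move=> pphi hphi; elim: s => [|i s [IHp IHb]].
  under eq_fun do rewrite big_nil; rewrite big_nil; split.
    exact: pwpoly_cst.
  exact: mesh_bound0.
under eq_fun do rewrite big_cons; rewrite big_cons; split.
  by apply: pwpolyD => //; exact: pwpolyZ.
exact: mesh_bound_lin.
Qed.

Lemma eq_mesh_bound v w M : {in E, v =1 w} -> mesh_bound w M -> mesh_bound v M.
Proof.
move=> vw hw p Ep.
have key (x y : R) : x = y -> `|y| <= M -> `|x| <= M by move=> ->.
have hx q : E q -> dx v q = dx w q by exact: eq_derive_mesh.
have hy q : E q -> dy v q = dy w q by exact: eq_derive_mesh.
have hx' : {in E, dx v =1 dx w} by move=> q; rewrite inE; exact: hx.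
have hy' : {in E, dy v =1 dy w} by move=> q; rewrite inE; exact: hy.
have [w0 w1 w2 [w3 w4 w5]] := hw p Ep.
split; [apply: key w0; apply: vw; exact/mem_set | exact: key (hx p Ep) w1
  | exact: key (hy p Ep) w2 | split].
- exact: key (eq_derive_mesh oU (1, 0) hx' Ep) w3.
- exact: key (eq_derive_mesh oU (1, 0) hy' Ep) w4.
- exact: key (eq_derive_mesh oU (0, 1) hy' Ep) w5.
Qed.

Lemma mesh_bound_lap v M : mesh_bound v M ->
  forall p, E p -> `|lap v p| <= M + M.
Proof.
move=> hM p Ep; have [_ _ _ [v1 _ v2]] := hM p Ep.
exact: le_trans (ler_normD _ _) (lerD v1 v2).
Qed.

Lemma form_a_le v w M N : pw v -> pw w -> mesh_bound v M -> mesh_bound w N ->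
  `|form_a Omega v w| <= (M + M) * (N + N) * mesh_area.
Proof.
move=> pv pw_ hM hN; apply: (ip_le oU bU pT).
- exact: pwpoly_lap.
- exact: pwpoly_lap.
- exact: mesh_bound_lap.
- exact: mesh_bound_lap.
Qed.

Lemma form_b0_le v w M N : pw v -> pw w -> mesh_bound v M -> mesh_bound w N ->
  `|form_b0 Omega v w| <= M * N * mesh_area.
Proof.
move=> pv pw_ hM hN; rewrite /form_b0.
have h1 : `|ip Omega (dx v) w| <= M * N * mesh_area.
  by apply: (ip_le oU bU pT (pwpoly_dx pv) pw_) => p Ep;
    [have [_ + _ _] := hM p Ep | have [+ _ _ _] := hN p Ep].
have h2 : `|ip Omega v (dx w)| <= M * N * mesh_area.
  by apply: (ip_le oU bU pT pv (pwpoly_dx pw_)) => p Ep;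
    [have [+ _ _ _] := hM p Ep | have [_ + _ _] := hN p Ep].
move: h1 h2; move: (ip _ _ _) (ip _ _ _) (M * N * _) => x y z.
by rewrite !ler_norml => /andP[? ?] /andP[? ?]; apply/andP; split; lra.
Qed.

Lemma form_b_le u v w L M N : pw u -> pw v -> pw w ->
  mesh_bound u L -> mesh_bound v M -> mesh_bound w N ->
  `|form_b Omega u v w| <= (L + L) * (M * N + M * N) * mesh_area.
Proof.
move=> pu pv pw_ hL hM hN; apply: (ip_le oU bU pT).
- exact: pwpoly_lap.
- by apply: pwpolyB; apply: pwpolyM;
    [exact: pwpoly_dy|exact: pwpoly_dx|exact: pwpoly_dx|exact: pwpoly_dy].
- exact: mesh_bound_lap.
move=> p Ep; have [_ v1 v2 _] := hM p Ep; have [_ w1 w2 _] := hN p Ep.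
apply: le_trans (ler_normB _ _) _; apply: lerD; rewrite normrM.
  exact: ler_pM (normr_ge0 _) (normr_ge0 _) v2 w1.
exact: ler_pM (normr_ge0 _) (normr_ge0 _) v1 w2.
Qed.

(** The factor 4 is 1 + 2 + 1, the weights of the three integrals in the seminorm. *)
Lemma H2_seminorm_le v M : pw v -> mesh_bound v M ->
  H2_seminorm Omega v ^+ 2 <= 4 * (M * M * mesh_area).
Proof.
move=> pv hM; rewrite /H2_seminorm.
have key f : pw f -> (forall p, E p -> `|f p| <= M) ->
    0 <= ip Omega f f <= M * M * mesh_area.
  move=> pf fM; rewrite ip_ge0/=.
  exact: le_trans (ler_norm _) (ip_le oU bU pT pf pf fM fM).
have fin (x y z K : R) : 0 <= x <= K -> 0 <= y <= K -> 0 <= z <= K ->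
    Num.sqrt (x + 2 * y + z) ^+ 2 <= 4 * K.
  by move=> /andP[? ?] /andP[? ?] /andP[? ?]; rewrite sqr_sqrtr; lra.
apply: fin; apply: key.
- exact: pwpoly_dx (pwpoly_dx pv).
- by move=> p Ep; have [_ _ _ []] := hM p Ep.
- exact: pwpoly_dx (pwpoly_dy pv).
- by move=> p Ep; have [_ _ _ []] := hM p Ep.
- exact: pwpoly_dy (pwpoly_dy pv).
- by move=> p Ep; have [_ _ _ []] := hM p Ep.
Qed.

End Bounds.

(** * Finite dimensional function spaces *)

Section LinearSpan.
Variables (R : realType) (X : Type) (S : (X -> R) -> Prop).
Hypothesis S0 : S (fun=> 0).
Hypothesis S_lin : forall c v w, S v -> S w -> S (fun p => c * v p + w p).

Lemma lin_sum_closed (I : Type) (s : seq I) (c : I -> R) (v : I -> X -> R) :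
  (forall i, S (v i)) -> S (fun p => \sum_(i <- s) c i * v i p).
Proof.
move=> Sv; elim: s => [|i s IH]; first by under eq_fun do rewrite big_nil.
by under eq_fun do rewrite big_cons; exact: S_lin.
Qed.

Lemma lin_zero (l : (X -> R) -> R) :
  (forall c v w, S v -> S w -> l (fun p => c * v p + w p) = c * l v + l w) ->
  l (fun=> 0) = 0.
Proof.
move=> l_lin; have := l_lin 1 _ _ S0 S0.
rewrite (_ : (fun=> 1 * 0 + 0) = (fun=> 0)); last by apply/funext => p; ring.
by rewrite mul1r; lra.
Qed.

Lemma lin_sumE (l : (X -> R) -> R) (I : Type) (s : seq I) (c : I -> R)
    (v : I -> X -> R) :
  (forall c v w, S v -> S w -> l (fun p => c * v p + w p) = c * l v + l w) ->
  (forall i, S (v i)) ->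
  l (fun p => \sum_(i <- s) c i * v i p) = \sum_(i <- s) c i * l (v i).
Proof.
move=> l_lin Sv; elim: s => [|i s IH].
  by under eq_fun do rewrite big_nil; rewrite big_nil lin_zero.
under eq_fun do rewrite big_cons; rewrite big_cons l_lin ?IH//.
exact: lin_sum_closed.
Qed.

Variables (A : set X) (L : set ((X -> R) -> R)) (D : nat).
Hypothesis L_lin : forall l, L l ->
  forall c v w, S v -> S w -> l (fun p => c * v p + w p) = c * l v + l w.
Hypothesis L_local : forall l v w, L l -> S v -> S w ->
  (forall x, A x -> v x = w x) -> l v = l w.
Hypothesis L_separates : forall v, S v -> (forall l, L l -> l v = 0) ->
  forall x, A x -> v x = 0.
Hypothesis S_dim : forall n (v : 'I_n -> X -> R), (D < n)%N ->
  (forall i, S (v i)) ->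
  exists2 c : 'I_n -> R, (exists i, c i != 0) &
    forall x, A x -> \sum_i c i * v i x = 0.

(** A biorthogonal family of maximal size must reproduce all of [S], since a remainder seen by some
    functional of [L] would enlarge it. The functionals come from a prescribed separating set; this
    is applied to point evaluations and to energy products. *)
Lemma dual_family : exists n (phi : 'I_n -> X -> R) (l : 'I_n -> (X -> R) -> R),
  [/\ forall j, S (phi j), forall j, L (l j) &
      forall v, S v -> forall x, A x -> v x = \sum_j l j v * phi j x].
Proof.
pose P n := exists (phi : 'I_n -> X -> R) (l : 'I_n -> (X -> R) -> R),
  [/\ forall j, S (phi j), forall j, L (l j) &
      forall i j, l i (phi j) = (i == j)%:R].
have P0 : exists n, `[< P n >].
  exists 0%N; apply/asboolP.
  by exists (fun=> fun=> 0), (fun=> fun=> 0); split; case.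
have PD n : `[< P n >] -> (n <= D)%N.
  move=> /asboolP[phi [l [Sphi Ll lphi]]]; rewrite leqNgt; apply/negP => Dn.
  (* A biorthogonal family is independent: [l i] applied to a vanishing combination returns its
     coefficient [c i]. Hence its size is at most [D]. *)
  have [c [i ci0] cphi] := S_dim Dn Sphi.
  move/negP: ci0; apply; apply/eqP.
  have := lin_sumE (index_enum _) c (L_lin (Ll i)) Sphi.
  rewrite (L_local (Ll i) (lin_sum_closed _ _ Sphi) S0 cphi).
  rewrite (lin_zero (L_lin (Ll i))) (bigD1 i)//= lphi eqxx mulr1 big1 ?addr0//.
  by move=> j ji; rewrite lphi eq_sym (negPf ji) mulr0.
have [n /asboolP[phi [l [Sphi Ll lphi]]] nmax] := ex_maxnP P0 PD.
exists n, phi, l; split => // v Sv x Ax.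
(* The remainder of [v] after its expansion, annihilated by every [l j]. *)
pose w p := -1 * (\sum_j l j v * phi j p) + v p.
have Ssum := lin_sum_closed (index_enum _) (fun j => l j v) Sphi.
have Sw : S w by exact: S_lin.
have lw j : l j w = 0.
  rewrite (L_lin (Ll j))// (lin_sumE _ _ (L_lin (Ll j)) Sphi) (bigD1 j)//=.
  rewrite lphi eqxx mulr1 big1 ?addr0 => [|i ij]; first by ring.
  by rewrite lphi eq_sym (negPf ij) mulr0.
suff w0 : w x = 0 by move: w0; rewrite /w; lra.
apply: (L_separates Sw) => // l' Ll'; apply: contrapT => l'w.
suff /asboolP/nmax : P n.+1 by rewrite ltnn.
pose new p := (l' w)^-1 * w p + 0.
have Snew : S new by exact: S_lin.
have lnew l0 : L l0 -> l0 new = (l' w)^-1 * l0 w.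
  by move=> Ll0; rewrite (L_lin Ll0)// (lin_zero (L_lin Ll0)) addr0.
(* [l'] joins the functionals with dual function [new], the remainder scaled so that [l' new = 1].
   The old [phi j] are corrected by multiples of [new] to be annihilated by [l']; the old [l j] do
   not see this, as they vanish on [new]. *)
pose phi' i p := if unlift ord_max i is Some j
  then - l' (phi j) * new p + phi j p else new p.
pose l2 (i : 'I_n.+1) := if unlift ord_max i is Some j then l j else l'.
exists phi', l2; split => [i|i|i j].
- by rewrite /phi'; case: unliftP => [j _|_] //; exact: S_lin.
- by rewrite /l2; case: unliftP.
have l'new : l' new = 1 by rewrite lnew// mulVf//; exact/eqP.
rewrite /phi' /l2.
case: (unliftP ord_max i) => [i' ->|->]; case: (unliftP ord_max j) => [j' ->|->].
- rewrite (L_lin (Ll i'))// lnew// lw mulr0 mulr0 add0r lphi.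
  by rewrite (inj_eq lift_inj).
- by rewrite lnew// lw mulr0 eq_sym (negPf (neq_lift _ _)).
- by rewrite (L_lin Ll')// l'new (negPf (neq_lift _ _)) mulr1 addNr.
- by rewrite l'new eqxx.
Qed.

End LinearSpan.

(** With more functions than coefficients, the matrix of coefficients has a nonzero vector in its
    left kernel; its entries are the [c l]. *)
Lemma piecewise_poly_dependent (R : realType) m (T : 'I_m -> set (R * R)) k n
    (v : 'I_n -> R * R -> R) :
  (m * k.+1 * k.+1 < n)%N -> (forall l, piecewise_poly T k (v l)) ->
  exists2 c : 'I_n -> R, (exists l, c l != 0) &
    forall i p, T i p -> \sum_l c l * v l p = 0.
Proof.
move=> kn pv.
have /choice[a av] l : exists a : 'I_m -> nat -> nat -> R, forall i p, T i p ->
    v l p = \sum_(r < k.+1) \sum_(s < k.+1 | (r + s <= k)%N)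
              a i r s * p.1 ^+ r * p.2 ^+ s.
  by have /choice[a av] := pv l; exists a.
pose I := ('I_m * 'I_k.+1 * 'I_k.+1)%type.
pose M : 'M[R]_(n, #|{: I}|) := \matrix_(l, e)
  let q : I := enum_val e in a l q.1.1 q.1.2 q.2.
have /rowV0Pn[x xM x0] : kermx M != 0.
  rewrite -mxrank_eq0 mxrank_ker subn_eq0 -ltnNge.
  by rewrite (leq_ltn_trans (rank_leq_col M))// !card_prod !card_ord.
exists (fun l => x 0 l).
  by have /rV0Pn[l xl] := x0; exists l.
move=> i p Tp.
under eq_bigr => l _.
  rewrite (av l i p Tp) mulr_sumr; under eq_bigr do rewrite mulr_sumr.
  over.
rewrite exchange_big big1//= => r _; rewrite exchange_big big1//= => s _.
transitivity ((\sum_l x 0 l * a l i r s) * (p.1 ^+ r * p.2 ^+ s)).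
  by rewrite mulr_suml; apply: eq_bigr => l _; rewrite !mulrA.
suff -> : \sum_l x 0 l * a l i r s = 0 by rewrite mul0r.
move: xM => /sub_kermxP/matrixP/(_ 0 (enum_rank ((i, r, s) : I))).
rewrite !mxE => xM; rewrite -[RHS]xM; apply: eq_bigr => l _.
by rewrite mxE enum_rankK.
Qed.

(** * Definiteness of the energy inner product *)

Lemma area_ball_gt0 (R : realType) (p : R * R) (e : R) :
  0 < e -> (0 < area R (ball p e))%E.
Proof.
move=> e0; rewrite (_ : ball p e = ball p.1 e `*` ball p.2 e)//.
rewrite product_measure1E; [|exact: measurable_ball..].
rewrite -[X in (_ < X)%E]/((lebesgue_measure (ball p.1 e) *
  lebesgue_measure (ball p.2 e))%E).
by rewrite !lebesgue_measure_ball ?(ltW e0)// -EFinM lte_fin mulr_gt0 ?mulrn_wgt0.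
Qed.

Section Definiteness.
Variables (R : realType) (Omega : set (R * R)) (m : nat).
Variable T : 'I_m -> set (R * R).
Hypothesis oU : open Omega.
Hypothesis bU : bounded_set Omega.
Hypothesis pT : partition_of T (closure Omega).

Lemma ip_self_eq0 (f : R * R -> R) : pwpoly T f ->
  (forall p, Omega p -> {for p, continuous f}) ->
  ip Omega f f = 0 -> forall p, Omega p -> f p = 0.
Proof.
move=> pf cf f0 p Up; apply: contrapT => /eqP fp0.
have [e e0 He] : exists2 e : R, 0 < e & forall q, ball p e q ->
    Omega q /\ `|f p| / 2 <= `|f q|.
  have fp2 : 0 < `|f p| / 2 by rewrite divr_gt0 ?normr_gt0.
  have /nbhs_ballP[e1 /= e10 h1] : nbhs p Omega by exact: open_nbhs_nbhs.
  have /nbhs_ballP[e2 /= e20 h2] : nbhs p [set q | `|f p - f q| < `|f p| / 2].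
    by have /cvgrPdist_lt/(_ _ fp2) := cf p Up.
  exists (Num.min e1 e2) => [|q pq]; first by rewrite lt_min e10.
  have q1 : ball p e1 q by apply: le_ball pq; rewrite ge_min lexx.
  have q2 : ball p e2 q by apply: le_ball pq; rewrite ge_min lexx orbT.
  split; [exact: h1|]; have := h2 _ q2; rewrite /=.
  have := ler_normD (f p - f q) (f q).
  by rewrite subrK; lra.
(* [Rintegral] sends an infinite integral to 0, so finiteness is needed before a vanishing [ip] says
   anything. *)
have fin : (\int[area R]_(q in Omega) (f q * f q)%:E)%E \is a fin_num.
  rewrite (eq_integral_mesh pT (g := fun q => (f q * f q)%:E))//.
  by apply: integrable_fin_num;
    [exact: mesh_interior_measurable |
     exact: (pwpoly_integrable oU bU (pwpolyM pf pf))].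
pose c := (`|f p| / 2) * (`|f p| / 2).
have c0 : 0 < c by rewrite mulr_gt0// divr_gt0// normr_gt0.
have : (\int[area R]_(q in ball p e) c%:E <=
    \int[area R]_(q in Omega) (f q * f q)%:E)%E.
  apply: (@ge0_le_integral_off_null _ _ _ (area R) set0) => //.
  - by move=> q /He[].
  - by move=> q _; rewrite lee_fin ltW.
  - by move=> q _; rewrite lee_fin -expr2 sqr_ge0.
  move=> q /He[_ fq] _; rewrite lee_fin -[f q * f q]ger0_norm -?expr2 ?sqr_ge0//.
  by rewrite expr2 normrM /c ler_pM.
have -> : (\int[area R]_(q in Omega) (f q * f q)%:E)%E = 0%E.
  by rewrite -[LHS]fineK//; congr EFin.
rewrite integral_cst; last first.
  by apply: open_measurable_prod; exact: ball_open.
by apply/negP; rewrite -ltNge mule_gt0 ?lte_fin ?area_ball_gt0.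
Qed.

Lemma zero_dx_const_on_segment (v : R * R -> R) (p : R * R) (s : R) :
  (forall q, Omega q -> derivable v q ((1, 0) : R * R)) ->
  (forall q, Omega q -> dx v q = 0) -> 0 <= s ->
  (forall r, 0 <= r <= s -> Omega (p.1 + r, p.2)) ->
  v (p.1 + s, p.2) = v p.
Proof.
move=> dv dv0; rewrite le_eqVlt => /predU1P[<- _|s0 seg].
  by rewrite addr0; case: p.
pose g r := v (p.1 + r, p.2).
have gE r (h : R) : g (h *: 1 + r) - g r =
    v (h *: ((1, 0) : R * R) + (p.1 + r, p.2)) - v (p.1 + r, p.2).
  rewrite /g; congr (v _ - _).
  transitivity (h *: (1 : R) + (p.1 + r), h *: (0 : R) + p.2) => //.
  by rewrite addrCA scaler0 add0r.
have dg r : 0 <= r <= s -> is_derive r 1 g 0.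
  move=> /seg Ur; have dvr := dv _ Ur.
  have qE : (fun h : R => h^-1 *: ((g \o shift r) (h *: 1) - g r)) =
      (fun h : R => h^-1 *: ((v \o shift (p.1 + r, p.2)) (h *: ((1, 0) : R * R))
         - v (p.1 + r, p.2))).
    by apply/funext => h; rewrite /= gE.
  apply: DeriveDef; first by move: dvr; rewrite /derivable qE.
  by have := dv0 _ Ur; rewrite /dx /derive qE.
have [r rs] : exists2 r, r \in `]0, s[ & g s - g 0 = 0 * (s - 0).
  apply: (MVT (df := fun=> 0)) => // [r|].
    by rewrite in_itv /= => /andP[r0 rs]; apply: dg; lra.
  apply: derivable_within_continuous => r; rewrite in_itv /= => rs.
  by have [] := dg r rs.
by rewrite mul0r => /eqP; rewrite subr_eq0 => /eqP; rewrite /g addr0; case: (p).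
Qed.

(* Moving in the first coordinate direction from any point of [Omega], one hits
   the boundary, where [v] vanishes; [v] is constant along the way. *)
Lemma zero_dx_eq0 (v : R * R -> R) k : piecewise_poly T k v ->
  (forall q, bdry Omega q -> v q = 0) ->
  (forall q, Omega q -> derivable v q ((1, 0) : R * R)) ->
  (forall q, Omega q -> dx v q = 0) ->
  forall p, Omega p -> v p = 0.
Proof.
move=> pv v0 dv dv0 p Up; apply: contrapT => vp.
(* Lengths that can be travelled from [p] without leaving [Omega]. The supremum [t] exists by
   boundedness, and [q] is the exit point, a limit of points where [v] equals [v p]. *)
pose A := [set s : R | 0 <= s /\ forall r, 0 <= r <= s -> Omega (p.1 + r, p.2)].
have A0 : A 0.
  split => // r r0; have -> : r = 0 by lra.
  by rewrite addr0; case: (p) Up.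
have [M [_ /(_ (`|M| + 1))bM]] := bU.
have {}bM q : Omega q -> `|q| <= `|M| + 1.
  by apply: bM; have := ler_norm M; lra.
have Aub : has_ubound A.
  exists (`|M| + 1 - p.1) => s [s0 /(_ s)]; rewrite s0 lexx => /(_ isT)/bM.
  rewrite prod_normE ge_max /= => /andP[+ _]; have := ler_norm (p.1 + s); lra.
have hsA : has_sup A by split => //; exists 0.
pose t := sup A; pose q : R * R := (p.1 + t, p.2).
have t0 : 0 <= t by by apply: (ub_le_sup Aub).
have below r : 0 <= r -> r < t -> A r.
  move=> r0 rt; have tr0 : 0 < t - r by lra.
  have [s [s0 As]] := sup_adherent tr0 hsA; rewrite -/t subKr => rs.
  by split => // r' r'r; apply: As; lra.
have nUq : ~ Omega q.
  move=> Uq; have /nbhs_ballP[e /= e0 He] : nbhs q Omega by exact: open_nbhs_nbhs.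
  have : A (t + e / 2).
    split => [|r /andP[r0 re]]; first lra.
    have [rt|tr] := ltP r t.
      by have [_] := below r r0 rt; apply; rewrite r0 lexx.
    apply: He; split => /=; last exact: ballxx.
    rewrite /ball /= ltr_norml; apply/andP; split; lra.
  by move=> /(ub_le_sup Aub); rewrite -/t; lra.
have t_gt0 : 0 < t.
  rewrite lt_neqAle t0 andbT; apply/eqP => t00; apply: nUq.
  by rewrite /q -t00 addr0; case: (p) Up.
have near_q (e : R) : 0 < e -> exists2 x, Omega x & ball q e x /\ v x = v p.
  move=> e0; pose r := Num.max 0 (t - e / 2).
  have r0 : 0 <= r by rewrite /r le_max lexx.
  have rt : r < t by rewrite /r gt_max t_gt0; lra.
  have re : t - e / 2 <= r by rewrite /r le_max lexx orbT.
  have [_ Ar] := below r r0 rt; exists (p.1 + r, p.2).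
    by apply: Ar; rewrite r0 lexx.
  split; last exact: zero_dx_const_on_segment.
  split => /=; last exact: ballxx.
  rewrite /ball /= ltr_norml; apply/andP; split; lra.
have clq : closure Omega q.
  move=> B /nbhs_ballP[e /= e0 eB]; have [x Ux [qx _]] := near_q e e0.
  by exists x; split => //; exact: eB.
have vq : v q = 0.
  by apply: v0; split => // /interior_subset.
have [cT _ _ covT _] := pT.
(* The boundary value is felt inside through the closed elements: one that contains [q] carries a
   polynomial vanishing at [q], any other stays away from [q]. As there are finitely many, [v p] is
   not attained near [q] on any of them. *)
have nearT i : \forall x \near q, T i x -> v x != v p.
  have clT : closed (T i) by apply: compact_closed => //; exact: cT.
  have [P pP vP] := piecewise_poly_polyfun pv i.
  have [Tq|nTq] := pselect (T i q); last first.
    have oC : open (~` T i) by exact: closed_openC.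
    near=> x => Tx; suff : (~` T i) x by [].
    by near: x; exact: open_nbhs_nbhs.
  have Pq : P q = 0 by rewrite -vP.
  have vp0 : 0 < `|v p| by rewrite normr_gt0; exact/eqP.
  have cP : P x @[x --> q] --> P q by exact: polyfun_continuous.
  have /cvgrPdist_lt/(_ _ vp0) := cP.
  apply: filterS => x /=; rewrite Pq sub0r normrN => Px Tx.
  by rewrite vP//; apply: contraTneq Px => ->; rewrite ltxx.
have /nbhs_ballP[e /= e0 He] := filter_forall (nbhs_filter q) nearT.
have [x Ux [qx vx]] := near_q e e0.
have : closure Omega x by exact: subset_closure.
rewrite -covT => -[i _ Tx].
by have := He x qx i Tx; rewrite vx eqxx.
Unshelve. all: by end_near. Qed.

End Definiteness.

(** * Clamped finite element functions *)

Section ClampedSpace.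
Variables (R : realType) (Omega : set (R * R)) (m : nat).
Variables (T : 'I_m -> set (R * R)) (k : nat) (Sh : set (R * R -> R)).
Implicit Types u v w psi : R * R -> R.
Hypothesis oU : open Omega.
Hypothesis bU : bounded_set Omega.
Hypothesis pT : partition_of T (closure Omega).
Hypothesis feS : C1_fe_space Omega T k Sh.

Local Notation E := (mesh_interior Omega T).
Local Notation S := (clamped Omega Sh).
Local Notation nrm := (grad_norm Omega).

Lemma clamped0 : S (fun=> 0).
Proof.
have [Sh0 _ _] := feS; split => // p n _ _; rewrite /normal_derivative_is.
under eq_fun do rewrite subrr mul0r.
exact: cvg_cst.
Qed.

Lemma clamped_lin (c : R) v w : S v -> S w -> S (fun p => c * v p + w p).
Proof.
have [_ Shlin _] := feS.
move=> [Sv v0 dv0] [Sw w0 dw0]; split; first exact: Shlin.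
  by move=> p bp; rewrite v0// w0// mulr0 addr0.
move=> p n bp np; rewrite /normal_derivative_is.
rewrite (_ : (fun s : R => _) = (fun s => c * ((v p - v (p - s *: n)) / s) +
    (w p - w (p - s *: n)) / s)); last by apply/funext => s; ring.
have := cvgD (cvgM (cvg_cst c) (dv0 p n bp np)) (dw0 p n bp np).
by rewrite mulr0 addr0; exact.
Qed.

Lemma clamped_pwpoly v : S v -> pwpoly T v.
Proof.
by have [_ _ h] := feS => -[/h[_ pv] _ _]; exact: piecewise_poly_pwpoly pv.
Qed.

Lemma ip_grad_definite v : S v -> ip_grad Omega v v = 0 ->
  forall p, Omega p -> v p = 0.
Proof.
move=> Sv gv0; have [Shv bv _] := Sv; have [_ _ /(_ _ Shv)[C1v pv]] := feS.
have pwv := clamped_pwpoly Sv.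
have dxv0 : ip Omega (dx v) (dx v) = 0.
  have := ip_ge0 Omega (dx v); have := ip_ge0 Omega (dy v); move: gv0.
  by rewrite /ip_grad; move: (ip _ _ _) (ip _ _ _) => x y *; lra.
apply: (zero_dx_eq0 oU bU pT pv bv).
  by move=> q /C1v[].
apply: (ip_self_eq0 oU bU pT (pwpoly_dx pwv)) => // q /C1v[_ _ cx _].
exact: cx.
Qed.

Lemma clamped_dim n (v : 'I_n -> R * R -> R) : (m * k.+1 * k.+1 < n)%N ->
  (forall i, S (v i)) ->
  exists2 c : 'I_n -> R, (exists i, c i != 0) &
    forall p, Omega p -> \sum_i c i * v i p = 0.
Proof.
move=> kn Sv.
have pv l : piecewise_poly T k (v l).
  by have [Shv _ _] := Sv l; have [_ _ /(_ _ Shv)[]] := feS.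
have [c c0 cv] := piecewise_poly_dependent kn pv.
exists c => // p Up; have [_ _ _ covT _] := pT.
have : closure Omega p by exact: subset_closure.
by rewrite -covT => -[i _ Tp]; exact: cv Tp.
Qed.

(** Point evaluations serve as dual functionals, so the coefficients of [psi t] are its values at
    fixed points, and the pointwise assumptions in time apply to them directly. *)
Lemma clamped_nodal_basis : exists n (phi : 'I_n -> R * R -> R) (z : 'I_n -> R * R),
  [/\ forall j, S (phi j), forall j, Omega (z j) &
      forall v, S v -> forall p, Omega p -> v p = \sum_j v (z j) * phi j p].
Proof.
pose L : set ((R * R -> R) -> R) :=
  [set l | exists2 z, Omega z & l = fun v => v z].
have [||||n [phi [l [Sphi Ll vE]]]] :=
    @dual_family R _ S clamped0 clamped_lin Omega L (m * k.+1 * k.+1).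
- by move=> _ [z Uz ->].
- by move=> _ v w [z Uz ->] Sv Sw; exact.
- by move=> v Sv v0 p Up; apply: (v0 (fun v => v p)); exists p.
- exact: clamped_dim.
have /choice[z zl] j : exists z, Omega z /\ l j = fun v => v z.
  by have [z] := Ll j; exists z.
exists n, phi, z; split => // [j|v Sv p Up]; first by have [] := zl j.
by rewrite (vE v Sv p Up); apply: eq_bigr => j _; have [_ ->] := zl j.
Qed.

Lemma ip_grad_cauchy_schwarz v w : S v -> S w ->
  `|ip_grad Omega v w| <= nrm v * nrm w.
Proof.
apply: (cauchy_schwarz clamped_lin) => [c u x y Su Sx Sy|x y|x].
- by apply: (ip_grad_linl oU bU pT); exact: clamped_pwpoly.
- exact: ip_gradC.
- exact: ip_grad_ge0.
Qed.

(** Energy products separate the functions by definiteness. Their use as coefficients is that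
    Cauchy-Schwarz bounds them by the energy norm. *)
Lemma clamped_energy_basis : exists n (phi w : 'I_n -> R * R -> R),
  [/\ forall j, S (phi j), forall j, S (w j) &
      forall v, S v -> forall p, Omega p ->
        v p = \sum_j ip_grad Omega v (w j) * phi j p].
Proof.
pose L : set ((R * R -> R) -> R) :=
  [set l | exists2 w, S w & l = fun v => ip_grad Omega v w].
have [||||n [phi [l [Sphi Ll vE]]]] :=
    @dual_family R _ S clamped0 clamped_lin Omega L (m * k.+1 * k.+1).
- move=> _ [w Sw ->] c u v Su Sv.
  by apply: (ip_grad_linl oU bU pT); exact: clamped_pwpoly.
- move=> _ v w [u Su ->] Sv Sw vw; apply: (eq_ip_gradl oU pT) => p.
  by rewrite inE => -[/vw].
- move=> v Sv v0; apply: ip_grad_definite => //.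
  by apply: (v0 (fun u => ip_grad Omega u v)); exists v.
- exact: clamped_dim.
have /choice[w wl] j : exists w, S w /\ l j = fun v => ip_grad Omega v w.
  by have [w] := Ll j; exists w.
exists n, phi, w; split => // [j|v Sv p Up]; first by have [] := wl j.
by rewrite (vE v Sv p Up); apply: eq_bigr => j _; have [_ ->] := wl j.
Qed.

(* In a finite dimensional space pointwise values and second derivatives are
   controlled by the energy norm: this is where constants depending on the
   mesh enter. *)
Lemma clamped_mesh_bound : exists2 K : R, 0 <= K &
  forall v, S v -> mesh_bound Omega T v (K * nrm v).
Proof.
have [n [phi [w [Sphi Sw vE]]]] := clamped_energy_basis.
have /choice[M HM] j : exists M : R, 0 <= M /\ mesh_bound Omega T (phi j) M.
  by have [M] := pwpoly_mesh_bound bU (clamped_pwpoly (Sphi j)); exists M.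
exists (\sum_j nrm (w j) * M j) => [|v Sv].
  by apply: sumr_ge0 => j _; rewrite mulr_ge0 ?sqrtr_ge0//; have [] := HM j.
have [_ b] := mesh_bound_sum (index_enum _) (fun j => ip_grad Omega v (w j))
  (fun j => clamped_pwpoly (Sphi j)) (fun j => (HM j).2).
have {}b : mesh_bound Omega T v (\sum_j `|ip_grad Omega v (w j)| * M j).
  apply: (eq_mesh_bound oU _ b) => p; rewrite inE => -[Up _]; exact: vE.
have le : \sum_j `|ip_grad Omega v (w j)| * M j <= (\sum_j nrm (w j) * M j) * nrm v.
  rewrite mulr_suml; apply: ler_sum => j _; have [M0 _] := HM j.
  rewrite mulrAC ler_wpM2r// mulrC; exact: ip_grad_cauchy_schwarz.
move=> p Ep; have [b0 b1 b2 [b3 b4 b5]] := b p Ep.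
split; [exact: le_trans b0 le|exact: le_trans b1 le|exact: le_trans b2 le|].
by split; [exact: le_trans b3 le|exact: le_trans b4 le|exact: le_trans b5 le].
Qed.

Lemma clamped_point_bound p : Omega p -> exists2 K : R, 0 <= K &
  forall v, S v -> `|v p| <= K * nrm v.
Proof.
have [n [phi [w [Sphi Sw vE]]]] := clamped_energy_basis => Up.
exists (\sum_j nrm (w j) * `|phi j p|) => [|v Sv].
  by apply: sumr_ge0 => j _; rewrite mulr_ge0 ?sqrtr_ge0.
rewrite (vE v Sv p Up) (le_trans (ler_norm_sum _ _ _))// mulr_suml.
apply: ler_sum => j _; rewrite normrM mulrAC ler_wpM2r// mulrC.
exact: ip_grad_cauchy_schwarz.
Qed.

(** Cauchy-Schwarz applied to each basis function gives the dual bound; the bound on the norm is the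
    case [chi = v] divided by [nrm v]. *)
Lemma clamped_sum_le n (phi : 'I_n -> R * R -> R) (c : 'I_n -> R) v :
  (forall j, S (phi j)) -> S v ->
  (forall p, Omega p -> v p = \sum_j c j * phi j p) ->
  (forall chi, S chi ->
    `|ip_grad Omega v chi| <= (\sum_j `|c j| * nrm (phi j)) * nrm chi) /\
  nrm v <= \sum_j `|c j| * nrm (phi j).
Proof.
move=> Sphi Sv vE.
have le chi : S chi ->
    `|ip_grad Omega v chi| <= (\sum_j `|c j| * nrm (phi j)) * nrm chi.
  move=> Sc; rewrite (eq_ip_gradl oU pT (v := fun p => \sum_j c j * phi j p)).
    rewrite (lin_sumE clamped0 clamped_lin (l := fun v => ip_grad Omega v chi))//.
      rewrite (le_trans (ler_norm_sum _ _ _))// mulr_suml; apply: ler_sum => j _.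
      by rewrite normrM -mulrA ler_wpM2l//; exact: ip_grad_cauchy_schwarz.
    by move=> c' u w Su Sw; apply: (ip_grad_linl oU bU pT); exact: clamped_pwpoly.
  by move=> p; rewrite inE => -[Up _]; exact: vE.
split => //; have [->|nv0] := eqVneq (nrm v) 0.
  by apply: sumr_ge0 => j _; rewrite mulr_ge0 ?sqrtr_ge0.
have nv : 0 < nrm v by rewrite lt_neqAle eq_sym nv0 sqrtr_ge0.
rewrite -(ler_pM2r nv); apply: le_trans (le v Sv).
by rewrite -expr2 sqr_sqrtr ?ip_grad_ge0// ler_norm.
Qed.

End ClampedSpace.

(** * Time regularity *)

Section Trajectory.
Variables (R : realType) (u w h : R -> R) (K C T : R).
Hypothesis T0 : 0 < T.
Hypothesis K0 : 0 <= K.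
Hypothesis u_right : u t @[t --> 0^'+] --> u 0.
Hypothesis du : forall t, 0 < t -> derivable u t 1.
Hypothesis w_int : forall s t, 0 < s -> s <= t ->
  lebesgue_measure.-integrable `[s, t] (EFin \o w).
Hypothesis u_tt : forall s t, 0 < s -> s <= t ->
  derive1 u t - derive1 u s = Rintegral lebesgue_measure `[s, t] w.
Hypothesis h0 : forall t, 0 <= h t.
Hypothesis wh : forall t, 0 < t -> w t ^+ 2 <= K * h t.
(* This is a lower integral: nothing is known on the measurability of [h]. *)
Hypothesis h_int : (\int[lebesgue_measure]_(s in `[0%R, T]) (h s)%:E <= C%:E)%E.

Let mu := @lebesgue_measure R.
(** Integrated backwards from [T], because [w] is known to be integrable only away from 0. The
    decrease of [Phi] dominates the variation of [derive1 u]. *)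
Let Phi (s : R) : R := Rintegral mu `[s, T] (fun r => `|w r|).

Let nw_int s t : 0 < s -> s <= t ->
  mu.-integrable `[s, t] (EFin \o (fun r => `|w r|)).
Proof. by move=> s0 st; apply: integrable_norm; exact: w_int. Qed.

Let Phi_le s : 0 < s -> s <= T -> Phi s <= T + (K + 1) * C.
Proof.
(* [y] is a measurable minorant of [h], which lets the bound on the lower integral through; [K + 1]
   stands for [K] to be invertible. Then [|w| <= 1 + w ^+ 2] gives a bound that does not blow up as
   [s] tends to 0. *)
move=> s0 sT; pose y r := (K + 1)^-1 * w r ^+ 2.
have K1 : 0 < K + 1 by have := K0; lra.
have mw : measurable_fun (`[s, T] : set R) w.
  by have /integrableP[/measurable_EFinP] := w_int s0 sT.
have my : measurable_fun (`[s, T] : set R) y.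
  apply: measurable_funM; first exact: measurable_cst.
  exact: measurable_funX.
have y0 r : 0 <= y r by rewrite mulr_ge0 ?sqr_ge0// invr_ge0 ltW.
have yint : (\int[mu]_(r in `[s, T]) (y r)%:E <= C%:E)%E.
  apply: le_trans h_int; apply: (@ge0_le_integral_off_null _ _ _ mu set0) => //.
  - by move=> r /=; rewrite !in_itv /= => /andP[? ?]; apply/andP; split; lra.
  - by move=> r _; rewrite lee_fin.
  - by move=> r _; rewrite lee_fin.
  move=> r /=; rewrite in_itv /= => /andP[sr rT] _; rewrite lee_fin /y.
  rewrite ler_pdivrMl//; apply: (le_trans (wh (lt_le_trans s0 sr))).
  by apply: ler_wpM2r; [exact: h0|lra].
have : (\int[mu]_(r in `[s, T]) `|w r|%:E <=
    \int[mu]_(r in `[s, T]) ((1%:E : \bar R) + (K + 1)%:E * (y r)%:E))%E.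
  apply: ge0_le_integral => //.
  - by apply/measurable_EFinP; exact: measurableT_comp.
  - apply/measurable_EFinP => /=.
    apply: measurable_funD; first exact: measurable_cst.
    by apply: measurable_funM => //; exact: measurable_cst.
  move=> r _; rewrite -EFinM -EFinD lee_fin /y mulVKf ?gt_eqF//.
  rewrite -(real_normK (num_real (w r))); have := sqr_ge0 (`|w r| - 1).
  by have := normr_ge0 (w r); nra.
rewrite ge0_integralD//; first last.
- apply/measurable_EFinP; apply: measurable_funM => //; exact: measurable_cst.
- by move=> r _; rewrite -EFinM lee_fin mulr_ge0// ltW.
rewrite ge0_integralZl_EFin//; first last.
- exact: ltW.
- by apply/measurable_EFinP.
- by move=> r _; rewrite lee_fin.
have -> : (\int[mu]_(r in `[s, T]) (1%:E : \bar R))%E = (T - s)%:E.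
  transitivity (lebesgue_measure (`[s, T]%classic : set R)).
    by rewrite integral_cst// mul1e.
  rewrite lebesgue_measure_itv /= lte_fin.
  case: ifPn => //; rewrite -leNgt => Ts; have -> : T = s by lra.
  by rewrite subrr.
move=> le1; rewrite /Phi /Rintegral.
rewrite -lee_fin fineK; last first.
  by apply: integrable_fin_num => //; exact: nw_int.
apply: (le_trans le1).
rewrite -[leRHS]/(T%:E + (K + 1)%:E * C%:E)%E; apply: leeD.
  by rewrite lee_fin; lra.
by rewrite lee_wpmul2l// lee_fin ltW.
Qed.

Let Phi_ge0 s : 0 <= Phi s.
Proof. by apply: Rintegral_ge0 => r _. Qed.

Let du_le s t : 0 < s -> s <= t -> t <= T ->
  `|derive1 u t - derive1 u s| <= Phi s - Phi t.
Proof.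
move=> s0 st tT; rewrite u_tt//.
apply: le_trans (le_normr_Rintegral _ (w_int s0 st)) _ => //.
have sT : s <= T by lra.
rewrite lerBrDr -lerBrDl /Phi.
rewrite (Rintegral_itvB (a := BLeft s) (b := BRight T) (nw_int s0 sT)) ?bnd_simp//.
rewrite Rintegral_itv_obnd_cbnd//.
apply: integrableS (nw_int (lt_le_trans s0 st) tT) => //.
by move=> r /=; rewrite !in_itv /= => /andP[/ltW -> ->].
Qed.

Let u_MVT s t : 0 <= s -> s < t ->
  exists2 x, s < x < t & u t - u s = derive1 u x * (t - s).
Proof.
move=> s0 st; have pos x : s < x -> 0 < x by exact: le_lt_trans.
have cu x : 0 < x -> {for x, continuous u}.
  by move=> x0; apply/differentiable_continuous/derivable1_diffP; exact: du.
have [||x] := @MVT R u (derive1 u) s t st.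
- move=> x; rewrite in_itv /= => /andP[/pos x0 _].
  by rewrite derive1E; apply/derivableP; exact: du.
- apply/(continuous_within_itvP _ st); split.
  + by move=> x; rewrite in_itv /= => /andP[/pos/cu].
  (* At [s = 0] differentiability is missing and right continuity takes its place. *)
  + move: s0; rewrite le_eqVlt => /predU1P[<-|/cu]; first exact: u_right.
    exact: cvg_at_right_filter.
  + exact/cvg_at_left_filter/cu/pos.
by rewrite in_itv /= => sxt uE; exists x.
Qed.

(* [V t - V s] is a bound for the variation of [derive1 u] on [`]s, t]]. *)
Lemma trajectory_regularity : exists (M : R) (V : R -> R),
  [/\ forall t, 0 < t -> t <= T -> `|u t| <= M /\ `|derive1 u t| <= M,
      0 <= V 0, V T <= M,
      forall s t, 0 <= s -> s <= t -> t <= T -> V s <= V t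
    & forall s t, 0 <= s -> s < t -> t <= T ->
        `|(u t - u s) / (t - s) - derive1 u t| <= V t - V s].
Proof.
(* [M0] is the uniform bound on [Phi], so [V] is nonnegative for positive times; it may jump at 0,
   which monotonicity tolerates. *)
pose M0 := T + (K + 1) * C; pose V t := if t <= 0 then 0 else M0 - Phi t.
have V0 : V 0 = 0 by rewrite /V lexx.
have Vpos t : 0 < t -> V t = M0 - Phi t by move=> t0; rewrite /V leNgt t0.
have Vle s t : 0 <= s -> s <= t -> t <= T -> V s <= V t.
  rewrite le_eqVlt => /predU1P[<- |s0 st tT].
    rewrite V0 le_eqVlt => /predU1P[<- _|t0 tT]; first by rewrite V0.
    by rewrite Vpos// subr_ge0 Phi_le.
  rewrite !Vpos//; last exact: lt_le_trans st.
  by have := du_le s0 st tT; have := normr_ge0 (derive1 u t - derive1 u s); lra.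
(* The quotient is the derivative at an intermediate point, so its distance to the derivative at [t]
   is a variation of [derive1 u]; no Taylor formula is involved. *)
have trunc s t : 0 <= s -> s < t -> t <= T ->
    `|(u t - u s) / (t - s) - derive1 u t| <= V t - V s.
  move=> s0 st tT; have [x /andP[sx xt] ->] := u_MVT s0 st.
  have ts : t - s != 0 by rewrite subr_eq0 gt_eqF.
  have x0 : 0 < x by exact: le_lt_trans sx.
  rewrite mulfK// distrC (le_trans (du_le x0 (ltW xt) tT))//.
  have Vsx := Vle s x s0 (ltW sx) (ltW (lt_le_trans xt tT)).
  by move: Vsx; rewrite (Vpos x)// (Vpos t) ?(lt_trans x0)//; lra.
have VT : V T <= M0 by rewrite Vpos//; have := Phi_ge0 T; lra.
pose M1 := `|derive1 u T| + M0.
have M00 : 0 <= M0 by rewrite -[leLHS]V0 (le_trans _ VT)// Vle// ltW.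
have du_M1 t : 0 < t -> t <= T -> `|derive1 u t| <= M1.
  move=> t0 tT; have := du_le t0 tT (lexx T).
  have := Phi_le t0 tT; have := Phi_ge0 T.
  have := ler_normD (derive1 u T) (- (derive1 u T - derive1 u t)).
  rewrite normrN opprB addrC subrK /M1 -/M0; lra.
have M10 : 0 <= M1 by rewrite addr_ge0.
exists (M1 + (`|u T| + M1 * T)), V; split => //.
- move=> t t0 tT; split.
    suff : `|u t| <= `|u T| + M1 * T by lra.
    move: tT; rewrite le_eqVlt => /predU1P[->|tT].
      by rewrite lerDl mulr_ge0// ltW.
    have [x /andP[tx xT] uE] := u_MVT (ltW t0) tT.
    have x0 : 0 < x by exact: lt_trans tx.
    have -> : u t = u T - derive1 u x * (T - t) by rewrite -uE; ring.
    rewrite (le_trans (ler_normB _ _))// lerD2l normrM.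
    apply: ler_pM => //; first exact: du_M1 (ltW xT).
    by rewrite ger0_norm; have := T0; lra.
  have := du_M1 t t0 tT; have := normr_ge0 (u T).
  by have := mulr_ge0 M10 (ltW T0); lra.
- by rewrite V0.
- have := normr_ge0 (u T); have := mulr_ge0 M10 (ltW T0).
  by have := normr_ge0 (derive1 u T); move: VT; rewrite /M1; lra.
Qed.

End Trajectory.

(** * Energy estimates for the backward Euler scheme *)

(** For x = tau K at most 1/2, (1 + 2x)(1 - x) >= 1, so the implicit term costs a factor 1 + 2x <=
    exp(2x) per step, and the increments of [W] telescope. *)
Lemma discrete_gronwall (R : realType) (err W : nat -> R) (tau K : R) (N : nat) :
  0 <= tau -> 0 <= K -> tau * K <= 1 / 2 -> err 0%N = 0 ->
  (forall n, 0 <= err n) ->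
  (forall n, (n < N)%N -> W n <= W n.+1) ->
  (forall n, (n < N)%N ->
     err n.+1 <= err n + tau * K * err n.+1 + tau * (W n.+1 - W n)) ->
  forall n, (n <= N)%N ->
    err n <= expR (2 * (tau * K) * n%:R) * (tau * (W n - W 0%N)).
Proof.
move=> tau0 K0 tauK err0 err_ge0 Wmono step.
have Wge n : (n <= N)%N -> W 0%N <= W n.
  elim: n => [//|n IH nN]; exact: le_trans (IH (ltnW nN)) (Wmono n nN).
elim=> [_|n IH nN]; first by rewrite err0 subrr !mulr0.
have {}IH := IH (ltnW nN); have {}step := step n nN; have dW := Wmono n nN.
have Wn := Wge n (ltnW nN); set x := tau * K in tauK IH step *.
have x0 : 0 <= x by exact: mulr_ge0.
have ex : 1 + 2 * x <= expR (2 * x) by exact: expR_ge1Dx.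
have q0 : 0 <= tau * (W n.+1 - W n) by rewrite mulr_ge0// subr_ge0.
have e1 : 1 <= expR (2 * x * n%:R).
  by rewrite -expR0 ler_expR mulr_ge0 ?mulr_ge0.
have s1 : err n.+1 <= (1 + 2 * x) * (err n + tau * (W n.+1 - W n)).
  have : (1 - x) * err n.+1 <= err n + tau * (W n.+1 - W n) by lra.
  have x2 : 0 <= 1 + 2 * x by lra.
  move=> /(ler_wpM2l x2); apply: le_trans; rewrite mulrA ler_peMl//.
  have x3 : 0 <= 1 - 2 * x by lra.
  by have := mulr_ge0 x0 x3; lra.
rewrite -(natr1 n) mulrDr mulr1 expRD.
have s2 : (1 + 2 * x) * (err n + tau * (W n.+1 - W n)) <=
    expR (2 * x) * (err n + tau * (W n.+1 - W n)).
  by rewrite ler_wpM2r// addr_ge0.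
apply: (le_trans s1); apply: (le_trans s2).
rewrite (mulrC _ (expR (2 * x))) -[leRHS]mulrA ler_wpM2l ?expR_ge0//.
have -> : tau * (W n.+1 - W 0%N) =
    tau * (W n - W 0%N) + tau * (W n.+1 - W n) by ring.
by rewrite [leRHS]mulrDr lerD// ler_peMl.
Qed.

Section BackwardEuler.
Variables (R : realType) (X : Type) (S : (X -> R) -> Prop).
Variables (g a b0 : (X -> R) -> (X -> R) -> R).
Variable b : (X -> R) -> (X -> R) -> (X -> R) -> R.
Variables (nu mu Ka K0 Kb : R).
Implicit Types u v w chi : X -> R.
Hypothesis S0 : S (fun=> 0).
Hypothesis S_lin : forall c v w, S v -> S w -> S (fun p => c * v p + w p).
Hypothesis g_linl : forall c u v w, S u -> S v -> S w ->
  g (fun p => c * u p + v p) w = c * g u w + g v w.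
Hypothesis a_linl : forall c u v w, S u -> S v -> S w ->
  a (fun p => c * u p + v p) w = c * a u w + a v w.
Hypothesis b0_linl : forall c u v w, S u -> S v -> S w ->
  b0 (fun p => c * u p + v p) w = c * b0 u w + b0 v w.
Hypothesis g_sym : forall v w, g v w = g w v.
Hypothesis g_ge0 : forall v, 0 <= g v v.
Hypothesis a_ge0 : forall v, 0 <= a v v.
Hypothesis b0_self : forall v, b0 v v = 0.
Hypothesis b_self : forall u v, b u v v = 0.
Hypothesis b_error : forall u v, S u -> S v ->
  let e := fun p => -1 * v p + u p in b u u e - b v v e = b e v e.
Hypothesis nu0 : 0 <= nu.

Let nrm v : R := Num.sqrt (g v v).
Let nrm_ge0 v : 0 <= nrm v. Proof. exact: sqrtr_ge0. Qed.
Let sqr_nrm v : nrm v * nrm v = g v v. Proof. by rewrite -expr2 sqr_sqrtr. Qed.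

Hypothesis g_le : forall v w, S v -> S w -> `|g v w| <= nrm v * nrm w.
Hypothesis a_le : forall v w, S v -> S w -> `|a v w| <= Ka * (nrm v * nrm w).
Hypothesis b0_le : forall v w, S v -> S w -> `|b0 v w| <= K0 * (nrm v * nrm w).
Hypothesis b_le : forall u v w, S u -> S v -> S w ->
  `|b u v w| <= Kb * (nrm u * (nrm v * nrm w)).
Hypothesis Ka0 : 0 <= Ka.
Hypothesis K00 : 0 <= K0.
Hypothesis Kb0 : 0 <= Kb.

Definition diff_quot (tau : R) v w : X -> R := fun p => (v p - w p) / tau.

Let diff_quotE tau v w : diff_quot tau v w =
  (fun p => tau^-1 * v p + (- tau^-1 * w p + 0)).
Proof. by apply/funext => p; rewrite /diff_quot; ring. Qed.

Lemma diff_quot_closed tau v w : S v -> S w -> S (diff_quot tau v w).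
Proof. by move=> Sv Sw; rewrite diff_quotE; do 2 apply: S_lin => //. Qed.

Lemma diff_quot_linl tau v w chi : S v -> S w -> S chi ->
  g (diff_quot tau v w) chi = (g v chi - g w chi) / tau.
Proof.
move=> Sv Sw Sc; rewrite diff_quotE g_linl//; last exact: S_lin.
rewrite g_linl// (lin_zero S0 (l := g^~ chi)); first by ring.
by move=> c u u' Su Su'; exact: g_linl.
Qed.

Lemma energy_triangle v w : S v -> S w ->
  nrm (fun p => -1 * v p + w p) <= nrm v + nrm w.
Proof.
move=> Sv Sw; have S' := S_lin (-1) Sv Sw.
rewrite -(@ler_pXn2r _ 2)// ?nnegrE ?addr_ge0//.
set f := fun p => _ in S' *.
have fE chi : S chi -> g f chi = -1 * g v chi + g w chi by exact: g_linl.
rewrite !expr2 sqr_nrm fE// (g_sym v f) (g_sym w f) !fE// (g_sym w v).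
rewrite -!sqr_nrm; have := g_le Sv Sw; rewrite ler_norml => /andP[+ _].
by move: (nrm v) (nrm w) (g v w) => x y z; lra.
Qed.

(** Divides an energy inequality by the norm of the test function. The resulting recursion is linear
    in the norm, so truncation errors add up without being squared. *)
Let cancel_nrm (x y c d : R) : 0 <= x -> 0 <= y -> 0 <= d ->
  x * x <= y * x + c * (x * x) + d * x -> x <= y + c * x + d.
Proof.
move=> x0 y0 d0 h; have [->|xn0] := eqVneq x 0.
  by rewrite mulr0 addr0 addr_ge0.
by rewrite -(@ler_pM2r _ x) ?lt_neqAle 1?eq_sym ?xn0//; lra.
Qed.

(** Tested with [e], the diffusion has a sign, the [b0] term vanishes and [b_error] leaves
    [b e psi e], controlled by [K]. Here [u] is the velocity of the semi-discrete solution and [rho]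
    bounds the truncation error as a functional. *)
Lemma error_step (tau rho K : R) u psi psi' Psi Psi' (load : (X -> R) -> R) :
  0 < tau -> 0 <= rho -> S u -> S psi -> S psi' -> S Psi -> S Psi' ->
  (forall chi, S chi -> g (diff_quot tau Psi Psi') chi + nu * a Psi chi +
     b Psi Psi chi + mu * b0 Psi chi = load chi) ->
  (forall chi, S chi -> g u chi + nu * a psi chi +
     b psi psi chi + mu * b0 psi chi = load chi) ->
  (forall chi, S chi ->
     `|g (diff_quot tau psi psi') chi - g u chi| <= rho * nrm chi) ->
  Kb * nrm psi <= K ->
  nrm (fun p => -1 * psi p + Psi p) <= nrm (fun p => -1 * psi' p + Psi' p) +
    tau * K * nrm (fun p => -1 * psi p + Psi p) + tau * rho.
Proof.
move=> tau0 rho0 Su Sp Sp' SP SP' eqP eqp trunc psiK.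
set e := fun p => -1 * psi p + Psi p; set e' := fun p => -1 * psi' p + Psi' p.
have Se : S e by exact: S_lin.
have Se' : S e' by exact: S_lin.
have h1 := eqP e Se; have h2 := eqp e Se.
have h3 := trunc e Se.
rewrite diff_quot_linl// in h1; rewrite diff_quot_linl// in h3.
have ge : g e e = - g psi e + g Psi e by rewrite {1}/e g_linl// mulN1r.
have ge' : g e' e = - g psi' e + g Psi' e by rewrite {1}/e' g_linl// mulN1r.
have ae : a e e = - a psi e + a Psi e by rewrite {1}/e a_linl// mulN1r.
have be : b0 e e = - b0 psi e + b0 Psi e by rewrite {1}/e b0_linl// mulN1r.
have bb := b_error SP Sp; rewrite /= -/e in bb.
have be0 := b0_self e; have ae0 := a_ge0 e.
have gle := g_le Se' Se; have ble := b_le Se Sp Se.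
apply: cancel_nrm => //; first by rewrite mulr_ge0// ltW.
have ble' : `|b e psi e| <= K * (nrm e * nrm e).
  apply: (le_trans ble).
  have -> : Kb * (nrm e * (nrm psi * nrm e)) = Kb * nrm psi * (nrm e * nrm e).
    by ring.
  by rewrite ler_wpM2r// mulr_ge0.
have key : g e e = g e' e - tau * (nu * a e e) - tau * b e psi e -
    tau * ((g psi e - g psi' e) / tau - g u e).
  rewrite -bb.
  have -> : b Psi Psi e - b psi psi e =
      g u e - (g Psi e - g Psi' e) / tau - nu * a e e.
    rewrite ae; have : mu * b0 Psi e = mu * b0 psi e by congr (_ * _); lra.
    lra.
  by rewrite ge ge'; field; rewrite gt_eqF.
move: h3; move: ((g psi e - g psi' e) / tau - g u e) key => y key.
rewrite ler_norml => /andP[y1 y2].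
move: ble'; rewrite ler_norml => /andP[b1 b2].
move: gle; rewrite ler_norml => /andP[_ gle].
have t1 : 0 <= tau * (nu * a e e).
  by apply: mulr_ge0; [exact: ltW | exact: mulr_ge0].
have t2 : 0 <= tau * (K * (nrm e * nrm e) + b e psi e).
  by apply: mulr_ge0; [exact: ltW | lra].
have t3 : 0 <= tau * (rho * nrm e + y).
  by apply: mulr_ge0; [exact: ltW | lra].
rewrite -sqr_nrm in key; lra.
Qed.

(** Tested with [Psi] itself, both skew terms vanish and the diffusion has a sign, so the bound
    holds for every step size. *)
Lemma stability_step (tau C : R) Psi Psi' (load : (X -> R) -> R) :
  0 < tau -> 0 <= C -> S Psi -> S Psi' ->
  (forall chi, S chi -> g (diff_quot tau Psi Psi') chi + nu * a Psi chi +
     b Psi Psi chi + mu * b0 Psi chi = load chi) ->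
  (forall chi, S chi -> `|load chi| <= C * nrm chi) ->
  nrm Psi <= nrm Psi' + tau * C.
Proof.
move=> tau0 C0 SP SP' eqP loadC.
have := eqP Psi SP; rewrite diff_quot_linl// b_self b0_self mulr0 !addr0 => h.
have := loadC Psi SP; rewrite ler_norml => /andP[_]; rewrite -h => h1.
have := g_le SP' SP; rewrite ler_norml => /andP[_ h2].
rewrite -[nrm Psi' as X in X + _]addr0 -[X in _ + X + _](mul0r (nrm Psi)).
apply: cancel_nrm => //; first by rewrite mulr_ge0// ltW.
rewrite sqr_nrm mul0r addr0.
have t1 : 0 <= tau * (nu * a Psi Psi).
  by apply: mulr_ge0; [exact: ltW | exact: mulr_ge0].
have t2 : 0 <= tau * (C * nrm Psi -
    ((g Psi Psi - g Psi' Psi) / tau + nu * a Psi Psi)).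
  by apply: mulr_ge0; [exact: ltW | lra].
have : tau * ((g Psi Psi - g Psi' Psi) / tau) = g Psi Psi - g Psi' Psi.
  by field; rewrite gt_eqF.
move: ((g Psi Psi - g Psi' Psi) / tau) t2 => y t2 yE.
lra.
Qed.

(** * Small and large time steps *)

Section Scheme.
Variables (psi u : R -> X -> R) (load : R -> (X -> R) -> R).
Variables (T M : R) (V : R -> R).
Hypothesis T0 : 0 < T.
Hypothesis M0 : 0 <= M.
Hypothesis S_psi : forall t, 0 <= t -> S (psi t).
Hypothesis S_u : forall t, 0 < t -> S (u t).
Hypothesis semidiscrete : forall t chi, 0 < t -> S chi ->
  g (u t) chi + nu * a (psi t) chi + b (psi t) (psi t) chi +
    mu * b0 (psi t) chi = load t chi.
Hypothesis psi_M : forall t, 0 < t -> t <= T -> nrm (psi t) <= M.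
Hypothesis u_M : forall t, 0 < t -> t <= T -> nrm (u t) <= M.
Hypothesis V0 : 0 <= V 0.
Hypothesis VT : V T <= M.
Hypothesis V_mono : forall s t, 0 <= s -> s <= t -> t <= T -> V s <= V t.
Hypothesis truncation : forall s t chi, 0 <= s -> s < t -> t <= T -> S chi ->
  `|g (diff_quot (t - s) (psi t) (psi s)) chi - g (u t) chi| <=
    (V t - V s) * nrm chi.

Let K := Kb * M + 1.
Let C1 := M + nu * (Ka * M) + Kb * (M * M) + `|mu| * (K0 * M).

Let C1_ge0 : 0 <= C1. Proof. by rewrite !addr_ge0// !mulr_ge0. Qed.

(** The load is read off the semi-discrete equation: its bound comes from those on [psi] and [u],
    uniformly in time, and not from the forcing. *)
Let load_le t chi : 0 < t -> t <= T -> S chi -> `|load t chi| <= C1 * nrm chi.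
Proof.
move=> t0 tT Sc; rewrite -semidiscrete//.
have Sp := S_psi (ltW t0); have pM := psi_M t0 tT; have uM := u_M t0 tT.
have h1 : `|g (u t) chi| <= M * nrm chi.
  by apply: le_trans (g_le (S_u t0) Sc) _; exact: ler_wpM2r.
have h2 : `|nu * a (psi t) chi| <= nu * (Ka * M) * nrm chi.
  rewrite normrM ger0_norm// -mulrA ler_wpM2l//.
  apply: le_trans (a_le Sp Sc) _; rewrite -mulrA ler_wpM2l//; exact: ler_wpM2r.
have h3 : `|b (psi t) (psi t) chi| <= Kb * (M * M) * nrm chi.
  apply: le_trans (b_le Sp Sp Sc) _; rewrite -mulrA ler_wpM2l// mulrA.
  by rewrite ler_wpM2r// ler_pM.
have h4 : `|mu * b0 (psi t) chi| <= `|mu| * (K0 * M) * nrm chi.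
  rewrite normrM -mulrA ler_wpM2l//.
  apply: le_trans (b0_le Sp Sc) _; rewrite -mulrA ler_wpM2l//; exact: ler_wpM2r.
rewrite /C1 !mulrDl.
by do 3 (apply: le_trans (ler_normD _ _) _; apply: lerD => //).
Qed.

Lemma backward_euler_error : exists2 C : R, 0 < C &
  forall (tau : R) (N : nat) (Psi : nat -> X -> R),
  0 < tau -> N%:R * tau = T -> (forall n, (n <= N)%N -> S (Psi n)) ->
  nrm (fun p => -1 * psi 0 p + Psi 0%N p) = 0 -> nrm (Psi 0%N) = nrm (psi 0) ->
  (forall n chi, (n < N)%N -> S chi ->
     g (diff_quot tau (Psi n.+1) (Psi n)) chi + nu * a (Psi n.+1) chi +
     b (Psi n.+1) (Psi n.+1) chi + mu * b0 (Psi n.+1) chi =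
     load (n.+1%:R * tau) chi) ->
  forall n, (n <= N)%N ->
    nrm (fun p => -1 * psi (n%:R * tau) p + Psi n p) <= C * tau.
Proof.
have K_gt0 : 0 < K by rewrite /K ltr_wpDl// mulr_ge0.
(* An a priori bound on the error: [nrm (psi 0) + T * C1] bounds the discrete solution by stability,
   and [M] the semi-discrete one. *)
pose B := nrm (psi 0) + T * C1 + M.
have B0 : 0 <= B by rewrite /B !addr_ge0// mulr_ge0// ltW.
(* The first term is the Gronwall bound when [tau * K <= 1 / 2]. Otherwise [1 < 2 * K * tau], and
   the bound [B] is at most [2 * K * B * tau]. The 1 makes the constant positive. *)
exists (expR (2 * (K * T)) * M + 2 * K * B + 1).
  by rewrite ltr_wpDl// addr_ge0// mulr_ge0 ?expR_ge0// mulr_ge0// ltW.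
move=> tau N Psi tau0 NT SPsi err0 Psi0 scheme.
have tau_ge0 := ltW tau0; have T_ge0 := ltW T0; have K_ge0 := ltW K_gt0.
pose err n := nrm (fun p => -1 * psi (n%:R * tau) p + Psi n p).
have err0' : err 0%N = 0 by rewrite /err mul0r.
have node_gt0 n : 0 < n.+1%:R * tau by rewrite mulr_gt0.
have node_T n : (n <= N)%N -> n%:R * tau <= T.
  by move=> nN; rewrite -NT ler_pM2r// ler_nat.
have node_S n : n.+1%:R * tau - n%:R * tau = tau by rewrite -(natr1 n); ring.
have eC : 0 <= expR (2 * (K * T)) * M by rewrite mulr_ge0 ?expR_ge0.
have KB : 0 <= 2 * K * B by rewrite !mulr_ge0.
case=> [_|n nN].
  by rewrite -/(err 0%N) err0' mulr_ge0// ltW// ltr_wpDl// addr_ge0.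
have [tauK|Ktau] := leP (tau * K) (1 / 2).
  have step i : (i < N)%N -> err i.+1 <= err i + tau * K * err i.+1 +
      tau * (V (i.+1%:R * tau) - V (i%:R * tau)).
    move=> iN.
    have it : i%:R * tau < i.+1%:R * tau by rewrite ltr_pM2r// ltr_nat.
    have i0 : 0 <= i%:R * tau by rewrite mulr_ge0.
    apply: (error_step (load := load (i.+1%:R * tau))
      (u := u (i.+1%:R * tau))) => //.
    - by rewrite subr_ge0 V_mono//; [exact: ltW|exact: node_T].
    - exact: S_u.
    - exact/S_psi/ltW.
    - exact: S_psi.
    - exact: SPsi.
    - by apply: SPsi; exact: ltnW.
    - by move=> chi Sc; exact: scheme.
    - by move=> chi Sc; exact: semidiscrete.
    - move=> chi Sc; rewrite -{1}(node_S i).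
      by apply: truncation => //; exact: node_T.
    - rewrite /K; apply: ler_wpDr => //; apply: ler_wpM2l => //.
      by apply: psi_M => //; exact: node_T.
  have := @discrete_gronwall R err (fun i => V (i%:R * tau)) tau K N (ltW tau0)
    (ltW K_gt0) tauK err0' (fun i => nrm_ge0 _) _ step n.+1 nN.
  move=> /(_ _)/le_trans; apply=> [i iN|].
    apply: V_mono; [by rewrite mulr_ge0| |exact: node_T].
    by rewrite ler_pM2r// ler_nat.
  rewrite mul0r.
  have Vn : V (n.+1%:R * tau) - V 0 <= M.
    have := V_mono (ltW (node_gt0 n)) (node_T _ nN) (lexx T).
    by have := V0; have := VT; lra.
  have e1 : expR (2 * (tau * K) * n.+1%:R) <= expR (2 * (K * T)).
    rewrite ler_expR.
    have -> : 2 * (tau * K) * n.+1%:R = 2 * K * (n.+1%:R * tau) by ring.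
    by rewrite -mulrA ler_wpM2l// ler_wpM2l// node_T.
  have Vn0 : 0 <= V (n.+1%:R * tau) - V 0.
    by rewrite subr_ge0 V_mono// ?mulr_ge0// node_T.
  have : expR (2 * (tau * K) * n.+1%:R) * (V (n.+1%:R * tau) - V 0) <=
      expR (2 * (K * T)) * M by rewrite ler_pM// expR_ge0.
  move=> /(ler_wpM2r tau_ge0) h; rewrite [tau * (_ - _)]mulrC [leLHS]mulrA.
  apply: (le_trans h); apply: ler_wpM2r => //.
  by rewrite -addrA lerDl addr_ge0.
have stab i : (i <= N)%N -> nrm (Psi i) <= nrm (psi 0) + i%:R * tau * C1.
  elim: i => [_|i IH iN]; first by rewrite Psi0 !mul0r addr0.
  have := @stability_step tau C1 (Psi i.+1) (Psi i) (load (i.+1%:R * tau)) tau0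
    C1_ge0 (SPsi _ iN) (SPsi _ (ltnW iN)) (fun chi Sc => scheme i chi iN Sc)
    (fun chi Sc => load_le (node_gt0 i) (node_T _ iN) Sc).
  move=> /le_trans; apply; have := IH (ltnW iN).
  by rewrite -(natr1 i); lra.
have e1 := energy_triangle (S_psi (ltW (node_gt0 n))) (SPsi _ nN).
have p1 := psi_M (node_gt0 n) (node_T _ nN).
have s1 := stab _ nN.
have s2 : n.+1%:R * tau * C1 <= T * C1 by rewrite ler_wpM2r// node_T.
apply: (le_trans e1); apply: (@le_trans _ _ B); first by rewrite /B; lra.
apply: (@le_trans _ _ (2 * K * B * tau)).
  have -> : 2 * K * B * tau = 2 * (tau * K) * B by ring.
  by rewrite ler_peMl//; lra.
rewrite ler_wpM2r// -addrA addrCA lerDl; lra.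
Qed.

End Scheme.

End BackwardEuler.

(** * The error of the fully discrete solution *)

Lemma derive1_sum (R : realType) (I : Type) (s : seq I) (c : I -> R -> R)
    (y : I -> R) (t : R) : (forall i, derivable (c i) t 1) ->
  is_derive t 1 (fun r => \sum_(i <- s) c i r * y i)
    (\sum_(i <- s) derive1 (c i) t * y i).
Proof.
move=> dc; elim: s => [|i s IH].
  under eq_fun do rewrite big_nil; rewrite big_nil; exact: is_derive_cst.
under eq_fun do rewrite big_cons; rewrite big_cons.
have h : is_derive t 1 (fun r => c i r * y i) (derive1 (c i) t * y i).
  have di : is_derive t 1 (c i) (derive1 (c i) t).
    by rewrite derive1E; exact/derivableP.
  apply: (is_derive_eq (is_deriveM di (is_derive_cst (y i) t 1))).
  by rewrite scaler0 add0r [LHS]mulrC.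
exact: is_deriveD.
Qed.

Section Assembly.
Variables (R : realType) (Omega : set (R * R)) (nu mu : R) (m : nat).
Variables (T : 'I_m -> set (R * R)) (k : nat) (Sh : set (R * R -> R)).
Variables (F : R -> R * R -> R) (psi0h : R * R -> R).
Variables (psi psi_tt : R -> R * R -> R) (alpha Creg : R).
Hypothesis oU : open Omega.
Hypothesis bU : bounded_set Omega.
Hypothesis nu0 : 0 < nu.
Hypothesis pT : partition_of T (closure Omega).
Hypothesis feS : C1_fe_space Omega T k Sh.
Hypothesis sd : semidiscrete_solution Omega (clamped Omega Sh) nu mu F psi0h psi.
Hypothesis psi2 : second_time_derivative Omega (clamped Omega Sh) psi psi_tt.
Hypothesis alpha0 : 0 <= alpha.
Hypothesis reg : forall t : R, 0 < t ->
     ((expR (- (2 * alpha * t)))%R%:E *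
      \int[@lebesgue_measure R]_(s in `[0%R, t])
        (expR (2 * alpha * s) * grad_norm Omega (psi_tt s) ^+ 2)%R%:E
      <= Creg%:E)%E.

Local Notation E := (mesh_interior Omega T).
Local Notation S := (clamped Omega Sh).
Local Notation nrm := (grad_norm Omega).
Local Notation g := (ip_grad Omega).

Let clin := clamped_lin feS.
Let cpw := clamped_pwpoly feS.

Lemma derive_sum_mesh (d : R * R) (I : Type) (s : seq I) (c : I -> R)
    (phi : I -> R * R -> R) : (forall i, S (phi i)) ->
  forall p, E p -> 'D_d (fun q => \sum_(i <- s) c i * phi i q) p =
    \sum_(i <- s) c i * 'D_d (phi i) p.
Proof.
move=> Sphi p Ep; elim: s => [|i s IH].
  under eq_fun do rewrite big_nil; rewrite big_nil; exact: derive_cst.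
under eq_fun do rewrite big_cons; rewrite big_cons.
have [_ [j _ Tp]] := Ep.
rewrite (derive_lin_mesh d (c i) (cpw (Sphi i)) _ Tp) ?IH//.
exact/cpw/(lin_sum_closed (clamped0 feS) clin).
Qed.

Section Nodal.
Variables (n : nat) (phi : 'I_n -> R * R -> R) (z : 'I_n -> R * R).
Hypothesis Sphi : forall j, S (phi j).
Hypothesis zU : forall j, Omega (z j).
Hypothesis vE : forall v, S v -> forall p, Omega p ->
  v p = \sum_j v (z j) * phi j p.

(** On [Omega] the time derivative of [psi] is known only pointwise; interpolating its nodal values
    yields an element of the space, admissible in the forms. *)
Definition discrete_velocity (t : R) : R * R -> R :=
  fun p => \sum_j time_deriv psi t (z j) * phi j p.

Lemma discrete_velocity_closed t : S (discrete_velocity t).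
Proof. exact: (lin_sum_closed (clamped0 feS) clin). Qed.

(** Time and space derivatives commute because, for [s] near [t], [psi s] is a finite sum of nodal
    values times fixed functions. *)
Lemma time_deriv_derive (d : R * R) t p : 0 < t -> E p ->
  time_deriv (fun s q => 'D_d (psi s) q) t p = 'D_d (discrete_velocity t) p.
Proof.
move=> t0 Ep; have [Spsi _ _ dpsi _] := sd; have [Up _] := Ep.
rewrite (derive_sum_mesh d _ _ Sphi Ep) /time_deriv.
have near_t : \forall s \near t, 'D_d (psi s) p =
    \sum_j psi s (z j) * 'D_d (phi j) p.
  near=> s; rewrite -(derive_sum_mesh d _ _ Sphi Ep).
  apply: (eq_derive_mesh oU d _ Ep) => q; rewrite inE => -[Uq _].
  apply: vE Uq; apply: Spsi; apply/ltW; near: s; exact: lt_nbhsr.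
have dj j : derivable (fun s => psi s (z j)) t 1 by exact: dpsi.
have [_ sumE] := derive1_sum (index_enum 'I_n) (fun j => 'D_d (phi j) p) dj.
by rewrite -[RHS]sumE derive1E; exact: near_eq_derive near_t.
Unshelve. all: by end_near. Qed.

Lemma discrete_velocity_eq t chi : 0 < t -> S chi ->
  g (discrete_velocity t) chi + nu * form_a Omega (psi t) chi +
  form_b Omega (psi t) (psi t) chi + mu * form_b0 Omega (psi t) chi =
  mu * ip Omega (F t) chi.
Proof.
move=> t0 Sc; have [_ _ _ _ /(_ t chi t0 Sc) <-] := sd.
have hx : ip Omega (time_deriv (fun s => dx (psi s)) t) (dx chi) =
    ip Omega (dx (discrete_velocity t)) (dx chi).
  exact: (eq_ip pT (fun p => time_deriv_derive (1, 0) t0 (p := p))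
    (fun p _ => erefl)).
have hy : ip Omega (time_deriv (fun s => dy (psi s)) t) (dy chi) =
    ip Omega (dy (discrete_velocity t)) (dy chi).
  exact: (eq_ip pT (fun p => time_deriv_derive (0, 1) t0 (p := p))
    (fun p _ => erefl)).
have hg : _ = g (discrete_velocity t) chi := congr2 +%R hx hy.
by rewrite -hg.
Qed.

Lemma nodal_regularity (T1 : R) j : 0 < T1 -> exists (M : R) (V : R -> R),
  [/\ forall t, 0 < t -> t <= T1 ->
        `|psi t (z j)| <= M /\ `|time_deriv psi t (z j)| <= M,
      0 <= V 0, V T1 <= M,
      forall s t, 0 <= s -> s <= t -> t <= T1 -> V s <= V t
    & forall s t, 0 <= s -> s < t -> t <= T1 ->
        `|(psi t (z j) - psi s (z j)) / (t - s) - time_deriv psi t (z j)|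
          <= V t - V s].
Proof.
move=> T0; have [Spsi _ rpsi dpsi _] := sd; have [Stt ptt] := psi2.
have [K K0 Kb] := clamped_point_bound oU bU pT feS (zU j).
(* The weight is at least 1 as [0 <= alpha], so [h] dominates the squared energy norm; the factor
   [expR (2 * alpha * T1)] in [hint] undoes the decaying factor of the assumption. *)
pose h (s : R) := expR (2 * alpha * s) * nrm (psi_tt s) ^+ 2.
have hint : (\int[lebesgue_measure]_(s in `[0%R, T1]) (h s)%:E <=
    (expR (2 * alpha * T1) * Creg)%:E)%E.
  by rewrite EFinM -lee_pdivrMl ?expR_gt0// -expRN; exact: reg.
apply: (trajectory_regularity (w := fun r => psi_tt r (z j)) (h := h)
  (K := K ^+ 2) T0 _ _ _ _ _ _ _ hint).
- exact: sqr_ge0.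
- exact: rpsi.
- by move=> t; exact: dpsi.
- by move=> s t s0 st; have [] := ptt (z j) s t (zU j) s0 st.
- by move=> s t s0 st; have [] := ptt (z j) s t (zU j) s0 st.
- by move=> t; rewrite mulr_ge0 ?expR_ge0 ?sqr_ge0.
move=> t t0; rewrite -(real_normK (num_real (psi_tt t (z j)))).
have n0 : 0 <= nrm (psi_tt t) by exact: sqrtr_ge0.
have e1 : 1 <= expR (2 * alpha * t).
  by rewrite -expR0 ler_expR !mulr_ge0// ltW.
apply: (@le_trans _ _ (K ^+ 2 * nrm (psi_tt t) ^+ 2)).
  rewrite -exprMn ler_pXn2r ?nnegrE ?mulr_ge0//.
  exact: Kb (Stt t t0).
by rewrite ler_wpM2l ?sqr_ge0// ler_peMl ?sqr_ge0.
Qed.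

End Nodal.

Lemma energy_error (T1 : R) : 0 < T1 -> exists2 C : R, 0 < C &
  forall (tau : R) (N : nat) (Psi : nat -> R * R -> R),
  0 < tau -> N%:R * tau = T1 ->
  backward_euler_solution Omega S nu mu F psi0h tau N Psi ->
  forall n, (n <= N)%N ->
    nrm (fun p => -1 * psi (n%:R * tau) p + Psi n p) <= C * tau.
Proof.
move=> T10; have [Spsi psi_init _ _ _] := sd.
have [n [phi [z [Sphi zU vE]]]] := clamped_nodal_basis pT feS.
have [K K0 Kb] := clamped_mesh_bound oU bU pT feS.
have /choice[MV HMV] j := nodal_regularity zU j T10.
have {HMV}/choice[V HV] j := HMV j.
(* The scalar bounds are summed with the energy norms of the basis functions as weights; by
   [clamped_sum_le] they become bounds in the energy norm. *)
pose W (t : R) := \sum_j V j t * nrm (phi j).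
pose M := \sum_j MV j * nrm (phi j).
have nphi j : 0 <= nrm (phi j) by exact: sqrtr_ge0.
pose A := fine (area R E).
have A0 : 0 <= A by exact: fine_ge0.
have cs := ip_grad_cauchy_schwarz oU bU pT feS.
have gl c u v w : S u -> S v -> S w ->
    g (fun p => c * u p + v p) w = c * g u w + g v w.
  by move=> Su Sv Sw; apply: (ip_grad_linl oU bU pT); exact: cpw.
have al c u v w : S u -> S v -> S w -> form_a Omega (fun p => c * u p + v p) w =
    c * form_a Omega u w + form_a Omega v w.
  by move=> Su Sv Sw; apply: (form_a_linl oU bU pT); exact: cpw.
have bl c u v w : S u -> S v -> S w -> form_b0 Omega (fun p => c * u p + v p) w =
    c * form_b0 Omega u w + form_b0 Omega v w.
  by move=> Su Sv Sw; apply: (form_b0_linl oU bU pT); exact: cpw.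
have be u v : S u -> S v -> let e := fun p => -1 * v p + u p in
    form_b Omega u u e - form_b Omega v v e = form_b Omega e v e.
  by move=> Su Sv; apply: (form_b_error oU bU pT); exact: cpw.
(* The pointwise bounds are [K] times energy norms, and the Laplacian doubles them; these identities
   collect the constants [Ka], [K0] and [Kb] of the abstract estimate. *)
have ra x y : 4 * K ^+ 2 * A * (x * y) = (K * x + K * x) * (K * y + K * y) * A.
  by ring.
have rb0 x y : K ^+ 2 * A * (x * y) = K * x * (K * y) * A by ring.
have rb x y w : 4 * K ^+ 3 * A * (x * (y * w)) = (K * x + K * x) *
    (K * y * (K * w) + K * y * (K * w)) * A by ring.
have ale v w : S v -> S w ->
    `|form_a Omega v w| <= 4 * K ^+ 2 * A * (nrm v * nrm w).
  move=> Sv Sw; rewrite (ra (nrm v) (nrm w)).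
  have := form_a_le oU bU pT (cpw Sv) (cpw Sw) (Kb v Sv) (Kb w Sw). exact.
have b0le v w : S v -> S w ->
    `|form_b0 Omega v w| <= K ^+ 2 * A * (nrm v * nrm w).
  move=> Sv Sw; rewrite (rb0 (nrm v) (nrm w)).
  have := form_b0_le oU bU pT (cpw Sv) (cpw Sw) (Kb v Sv) (Kb w Sw); exact.
have ble u v w : S u -> S v -> S w ->
    `|form_b Omega u v w| <= 4 * K ^+ 3 * A * (nrm u * (nrm v * nrm w)).
  move=> Su Sv Sw; rewrite (rb (nrm u) (nrm v) (nrm w)).
  have := form_b_le oU bU pT (cpw Su) (cpw Sv) (cpw Sw)
    (Kb u Su) (Kb v Sv) (Kb w Sw).
  exact.
have MV0 j : 0 <= MV j.
  have [/(_ T1 T10 (lexx T1))[+ _] _ _ _ _] := HV j.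
  by apply: le_trans.
have M0 : 0 <= M by apply: sumr_ge0 => j _; exact: mulr_ge0.
have uE t p : Omega p -> discrete_velocity phi z t p =
    \sum_j time_deriv psi t (z j) * phi j p by [].
have Su t : S (discrete_velocity phi z t) by exact: discrete_velocity_closed.
have psiM t : 0 < t -> t <= T1 -> nrm (psi t) <= M.
  move=> t0 tT; have St := Spsi t (ltW t0).
  apply: le_trans (clamped_sum_le oU bU pT feS Sphi St (vE _ St)).2 _.
  apply: ler_sum => j _; apply: ler_wpM2r => //.
  by have [/(_ t t0 tT)[]] := HV j.
have uM t : 0 < t -> t <= T1 -> nrm (discrete_velocity phi z t) <= M.
  move=> t0 tT.
  apply: le_trans (clamped_sum_le oU bU pT feS Sphi (Su t) (uE t)).2 _.
  apply: ler_sum => j _; apply: ler_wpM2r => //.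
  by have [/(_ t t0 tT)[]] := HV j.
have W0 : 0 <= W 0.
  by apply: sumr_ge0 => j _; apply: mulr_ge0 => //; have [] := HV j.
have WT : W T1 <= M.
  by apply: ler_sum => j _; apply: ler_wpM2r => //; have [] := HV j.
have Wm s t : 0 <= s -> s <= t -> t <= T1 -> W s <= W t.
  move=> s0 st tT; apply: ler_sum => j _; apply: ler_wpM2r => //.
  by have [_ _ _ h _] := HV j; exact: h.
have trunc s t chi : 0 <= s -> s < t -> t <= T1 -> S chi ->
    `|g (diff_quot (t - s) (psi t) (psi s)) chi -
      g (discrete_velocity phi z t) chi| <= (W t - W s) * nrm chi.
  move=> s0 st tT Sc; have t0 : 0 < t by exact: le_lt_trans st.
  have Ss := Spsi s s0; have St := Spsi t (ltW t0).
  have Sd := diff_quot_closed (clamped0 feS) clin (t - s) St Ss.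
  have Sr := clin (-1) (Su t) Sd.
  have gE := gl (-1) _ _ _ (Su t) Sd Sc.
  (* The nodal truncation errors are the coefficients of the truncation error in the nodal basis. *)
  pose r j := (psi t (z j) - psi s (z j)) / (t - s) - time_deriv psi t (z j).
  have rE p : Omega p -> -1 * discrete_velocity phi z t p +
      diff_quot (t - s) (psi t) (psi s) p = \sum_j r j * phi j p.
    move=> Up; rewrite /diff_quot (vE _ St p Up) (vE _ Ss p Up) uE//.
    rewrite -sumrB mulr_suml mulr_sumr -big_split /=; apply: eq_bigr => j _.
    by rewrite /r; ring.
  have [le _] := clamped_sum_le oU bU pT feS Sphi Sr rE.
  have -> : g (diff_quot (t - s) (psi t) (psi s)) chi -
      g (discrete_velocity phi z t) chi = g (fun p => -1 *
      discrete_velocity phi z t p + diff_quot (t - s) (psi t) (psi s) p) chi.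
    by rewrite gE mulN1r addrC.
  apply: le_trans (le chi Sc) _.
  apply: ler_wpM2r; first exact: sqrtr_ge0.
  rewrite /W -sumrB; apply: ler_sum => j _; rewrite -mulrBl.
  by apply: ler_wpM2r => //; have [_ _ _ _ h] := HV j; exact: h.
have K20 : 0 <= K ^+ 2 * A by rewrite mulr_ge0// sqr_ge0.
have K30 : 0 <= 4 * K ^+ 3 * A by rewrite !mulr_ge0// exprn_ge0.
have K240 : 0 <= 4 * K ^+ 2 * A by rewrite -mulrA mulr_ge0.
have [C C0 HC] := backward_euler_error (clamped0 feS) clin gl al bl (ip_gradC Omega)
  (ip_grad_ge0 Omega) (form_a_ge0 Omega) (form_b0_self Omega) (form_b_self Omega)
  be (ltW nu0) cs ale b0le ble K240 K20 K30 T10 M0 Spsi (fun t _ => Su t)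
  (fun t chi => discrete_velocity_eq Sphi zU vE (t := t) (chi := chi))
  psiM uM W0 WT Wm trunc.
exists C => // tau N Psi tau0 NT [SP0 P0 scheme].
have SP i : (i <= N)%N -> S (Psi i).
  by case: i => // i iN; have [] := scheme i.+1 iN.
have S00 := Spsi 0 (lexx 0).
(* The initial functions are known to agree only on [Omega]; since [E] is open this already
   determines their gradients on [E]. *)
have P0E : {in E, Psi 0%N =1 psi 0}.
  by move=> p; rewrite inE => -[Up _]; rewrite P0// psi_init.
have g0 chi : S chi -> g (fun=> 0) chi = 0.
  move=> Sc; apply: (lin_zero (clamped0 feS) (l := fun v => g v chi)).
  by move=> c v w Sv Sw; exact: gl.
have e0 : {in E, (fun p => -1 * psi 0 p + Psi 0%N p) =1 (fun=> 0)}.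
  by move=> p /P0E ->; rewrite mulN1r addNr.
have h1 : nrm (fun p => -1 * psi 0 p + Psi 0%N p) = 0.
  rewrite /grad_norm (eq_ip_gradl oU pT _ e0) g0 ?sqrtr0//.
  exact: clin S00 (SP 0%N (leq0n N)).
have h2 : nrm (Psi 0%N) = nrm (psi 0).
  rewrite /grad_norm (eq_ip_gradl oU pT (Psi 0%N) P0E) ip_gradC.
  by rewrite (eq_ip_gradl oU pT (psi 0) P0E).
have h3 i chi : (i < N)%N -> S chi ->
    g (diff_quot tau (Psi i.+1) (Psi i)) chi + nu * form_a Omega (Psi i.+1) chi +
    form_b Omega (Psi i.+1) (Psi i.+1) chi + mu * form_b0 Omega (Psi i.+1) chi =
    mu * ip Omega (F (i.+1%:R * tau)) chi.
  by move=> iN Sc; have [_ h] := scheme i.+1 iN; exact: h.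
exact: (HC tau N Psi tau0 NT SP h1 h2 h3).
Qed.

End Assembly.

(** * From the energy norm to the weighted sum of H2 seminorms *)

Unset Implicit Arguments.
Set Strict Implicit.

Theorem theorem5p7 (R : realType)
    (Omega : set (R * R)) (nu mu lam1 : R)
    (m : nat) (T : 'I_m -> set (R * R)) (sigma : R) (k : nat)
    (Sh : set (R * R -> R))
    (F : R -> R * R -> R) (psi0h : R * R -> R)
    (psi psi_tt : R -> R * R -> R) (alpha Creg : R) :
  bounded_domain Omega ->
  0 < nu -> 0 < mu ->
  0 < lam1 -> min_dirichlet_eigenvalue Omega lam1 ->
  partition_of T (closure Omega) -> shape_regular T sigma ->
  (3 <= k)%N -> C1_fe_space Omega T k Sh ->
  (forall t : R, 0 <= t -> square_integrable Omega (F t)) ->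
  semidiscrete_solution Omega (clamped Omega Sh) nu mu F psi0h psi ->
  second_time_derivative Omega (clamped Omega Sh) psi psi_tt ->
  0 <= alpha -> alpha < nu * lam1 / 4 ->
  (forall t : R, 0 < t ->
     ((expR (- (2 * alpha * t)))%R%:E *
      \int[@lebesgue_measure R]_(s in `[0%R, t])
        (expR (2 * alpha * s) * grad_norm Omega (psi_tt s) ^+ 2)%R%:E
      <= Creg%:E)%E) ->
  exists2 beta1 : R, 0 < beta1 &
  exists2 C : R -> R, (forall t : R, 0 < C t) &
  forall (tau : R) (N : nat) (Psi : nat -> R * R -> R),
    0 < tau ->
    expR (alpha * tau) < nu * tau * lam1 / 4 + 1 ->
    backward_euler_solution Omega (clamped Omega Sh) nu mu F psi0h tau N Psi ->
    forall n, (1 <= n <= N)%N ->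
      let t_ := time_node tau in
      let e_ := fun (i : nat) (p : R * R) => Psi i p - psi (t_ i) p in
      grad_norm Omega (e_ n) ^+ 2 +
      beta1 * tau * expR (- (2 * alpha * t_ n)) *
        (\sum_(1 <= i < n.+1)
           expR (2 * alpha * t_ i) * H2_seminorm Omega (e_ i) ^+ 2)
      <= C (t_ N) * tau ^+ 2.
Proof.
move=> [oU _ _ bU] nu0 _ _ _ pT _ _ feS _ sd psi2 alpha0 _ reg.
have [K K0 Kb] := clamped_mesh_bound oU bU pT feS.
pose A := fine (area R (mesh_interior Omega T)).
have A0 : 0 <= A by exact: fine_ge0.
pose K2 := 4 * (K * K * A).
have K20 : 0 <= K2 by rewrite /K2 !mulr_ge0.
have H2_le v : clamped Omega Sh v ->
    H2_seminorm Omega v ^+ 2 <= K2 * grad_norm Omega v ^+ 2.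
  move=> Sv; have := H2_seminorm_le oU bU pT (clamped_pwpoly feS Sv) (Kb v Sv).
  have -> : 4 * (K * grad_norm Omega v * (K * grad_norm Omega v) * A) =
      K2 * grad_norm Omega v ^+ 2 by rewrite /K2; move: (grad_norm _ _) => x; ring.
  exact.
(* The constant must be a function of the final time, fixed before the step and the number of steps;
   for [t <= 0] any positive value will do. *)
have /choice[C0 HC0] (t : R) : exists C : R, 0 < C /\ (0 < t ->
    forall (tau : R) (N : nat) (Psi : nat -> R * R -> R),
    0 < tau -> N%:R * tau = t ->
    backward_euler_solution Omega (clamped Omega Sh) nu mu F psi0h tau N Psi ->
    forall n, (n <= N)%N ->
    grad_norm Omega (fun p => -1 * psi (n%:R * tau) p + Psi n p) <= C * tau).
  have [t0|_] := ltP 0 t; last by exists 1.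
  have [C C0 HC] := energy_error oU bU nu0 pT feS sd psi2 alpha0 reg t0.
  by exists C.
(* The first summand pays for the energy norm. The second pays for the sum: [n] terms, each at most
   [K2 * C0 t ^+ 2 * tau ^+ 2], times [tau], with [n%:R * tau] at most the final time. The absolute
   value keeps the constant positive for every [t]. *)
exists 1 => //; exists (fun t => C0 t ^+ 2 + K2 * `|t| * C0 t ^+ 2) => [t|].
  have [C00 _] := HC0 t; rewrite ltr_wpDr ?exprn_gt0//.
  by apply: mulr_ge0; [exact: mulr_ge0|exact: sqr_ge0].
move=> tau N Psi tau0 _ sol n /andP[n1 nN] /=.
set e_ := fun (i : nat) (p : R * R) => Psi i p - psi (time_node tau i) p.
have tau_ge0 := ltW tau0.
have N0 : (0 < N)%N by exact: leq_trans nN.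
have tN0 : 0 < time_node tau N by rewrite /time_node mulr_gt0// ltr0n.
have [C00 /(_ tN0 tau N Psi tau0 erefl sol) HC] := HC0 (time_node tau N).
set C := C0 _ in C00 HC *.
have eE i : e_ i = fun p => -1 * psi (i%:R * tau) p + Psi i p.
  by apply/funext => p; rewrite /e_ /time_node mulN1r addrC.
have [Spsi _ _ _ _] := sd; have [SP0 _ scheme] := sol.
have Se i : (i <= N)%N -> clamped Omega Sh (e_ i).
  move=> iN; rewrite eE; apply: (clamped_lin feS).
    by apply: Spsi; rewrite mulr_ge0.
  by case: i iN => // i iN; have [] := scheme i.+1 iN.
have err i : (i <= N)%N -> grad_norm Omega (e_ i) ^+ 2 <= C ^+ 2 * tau ^+ 2.
  move=> iN; rewrite -exprMn.
  have n0 : 0 <= grad_norm Omega (e_ i) by exact: sqrtr_ge0.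
  have le : grad_norm Omega (e_ i) <= C * tau by rewrite eE; exact: HC.
  by rewrite ler_pXn2r// nnegrE (le_trans n0 le).
have sum_le : tau * expR (- (2 * alpha * time_node tau n)) *
    (\sum_(1 <= i < n.+1) expR (2 * alpha * time_node tau i) *
       H2_seminorm Omega (e_ i) ^+ 2) <=
    tau * (n%:R * (K2 * (C ^+ 2 * tau ^+ 2))).
  rewrite -mulrA ler_wpM2l// mulr_sumr.
  have -> : n%:R * (K2 * (C ^+ 2 * tau ^+ 2)) =
      \sum_(1 <= i < n.+1) K2 * (C ^+ 2 * tau ^+ 2).
    by rewrite sumr_const_nat subSS subn0 mulr_natl.
  rewrite big_nat_cond [leRHS]big_nat_cond; apply: ler_sum => i.
  rewrite andbT ltnS => /andP[_ i_n]; have iN := leq_trans i_n nN.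
  (* The two exponential weights combine to exp(-2 alpha (t_n - t_i)), which is at most 1 because
     [i <= n]. *)
  rewrite mulrA -expRD; apply: (@le_trans _ _ (H2_seminorm Omega (e_ i) ^+ 2)).
    rewrite ler_piMl ?sqr_ge0// -expR0 ler_expR addrC subr_le0.
    by rewrite ler_wpM2l ?mulr_ge0// /time_node ler_wpM2r// ler_nat.
  by apply: (le_trans (H2_le _ (Se i iN))); rewrite ler_wpM2l// err.
rewrite mul1r [leRHS]mulrDl; apply: lerD; first exact: err.
apply: (le_trans sum_le).
have -> : K2 * `|time_node tau N| * C ^+ 2 * tau ^+ 2 =
    `|time_node tau N| * (K2 * (C ^+ 2 * tau ^+ 2)) by ring.
rewrite mulrA; apply: ler_wpM2r.
  by apply: mulr_ge0 => //; apply: mulr_ge0; exact: sqr_ge0.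
by rewrite (ger0_norm (ltW tN0)) mulrC /time_node ler_wpM2r// ler_nat.
Qed.
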